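(* Let $p$ be a prime and let $\mathcal{F}$ be a saturated fusion system over a discrete $p$-toral group $S$ such that either $Z(\mathcal{F})=1$ or $\mathfrak{foc}(\mathcal{F})=S$. Then $\mathcal{F}$ factors as a product $\mathcal F=\mathcal E_1\times\cdots\times\mathcal E_k$ of indecomposable fusion subsystems (all over nontrivial subgroups of $S$ if $k\ge2$) in a unique way, up to the ordering of the factors. Thus $\mathcal{F}$ is the direct product of all of its indecomposable direct factors.
   Context: $\mathbb{Z}/p^\infty$ is the union of the chain $\mathbb{Z}/p\le\mathbb{Z}/p^2\le\cdots$ of finite cyclic $p$-groups. A discrete $p$-toral group is a group $S$ with a normal subgroup $S_0$ such that $S_0$ is isomorphic to a finite product of copies of $\mathbb{Z}/p^\infty$ and $S/S_0$ is a finite $p$-group. For $P,Q\le S$, $\mathrm{Inj}(P,Q)$ is the set of injective homomorphisms $P\to Q$, $\mathrm{Hom}_S(P,Q)$ is the set of homomorphisms $P\to Q$ of the form $x\mapsto c_g(x)=gxg^{-1}$ with $g\in S$, and $\mathrm{Aut}_S(P)=\mathrm{Hom}_S(P,P)\cap\mathrm{Aut}(P)$. A fusion system $\mathcal{F}$ over $S$ is a category whose objects are the subgroups of $S$, with $\mathrm{Hom}_S(P,Q)\subseteq\mathrm{Hom}_{\mathcal F}(P,Q)\subseteq\mathrm{Inj}(P,Q)$ for all $P,Q\le S$, and such that every morphism in $\mathcal F$ factors as an isomorphism in $\mathcal F$ followed by an inclusion. Subgroups $P,P'$ are $\mathcal F$-conjugate if they are isomorphic in $\mathcal F$; elements $x,y$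 are $\mathcal F$-conjugate if some $\varphi\in\mathrm{Hom}_{\mathcal F}(\langle x\rangle,\langle y\rangle)$ has $\varphi(x)=y$; the conjugacy classes are $P^{\mathcal F}$ and $x^{\mathcal F}$. $P\le S$ is fully automized if the index of $\mathrm{Aut}_S(P)$ in $\mathrm{Aut}_{\mathcal F}(P)$ is finite and prime to $p$; $P$ is receptive if for each $Q\in P^{\mathcal F}$ and each isomorphism $\varphi\in\mathrm{Iso}_{\mathcal F}(Q,P)$, $\varphi$ extends to some $\bar\varphi\in\mathrm{Hom}_{\mathcal F}(N_\varphi,S)$, where $N_\varphi=\{g\in N_S(Q)\mid \varphi c_g\varphi^{-1}\in\mathrm{Aut}_S(P)\}$. $\mathcal F$ is saturated if (i) each $P\le S$ is $\mathcal F$-conjugate to a subgroup that is fully automized and receptive; and (ii) whenever $P_1\le P_2\le\cdots$ are subgroups of $S$ with union $P_\infty$ and $\varphi\in\mathrm{Hom}(P_\infty,S)$ satisfies $\varphi|_{P_n}\in\mathrm{Hom}_{\mathcal F}(P_n,S)$ for all $n$, then $\varphi\in\mathrm{Hom}_{\mathcal F}(P_\infty,S)$. A subgroup $P\le S$ is central in $\mathcal F$ if each $\varphi\in\mathrm{Hom}_{\mathcal F}(Q,R)$ ($Q,R\le S$) extends to some $\bar\varphi\in\mathrm{Hom}_{\mathcal F}(QP,RP)$ with $\bar\varphi|_P=\mathrm{Id}_P$. $Z(\mathcal F)$ is the subgroup generated by all subgroups central in $\mathcal F$, and $\mathfrak{foc}(\mathcal F)=\langle xy^{-1}\mid x,y\in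 S,\ y\in x^{\mathcal F}\rangle$. A fusion subsystem of $\mathcal F$ is a subcategory $\mathcal E$ whose objects are the subgroups of some $T\le S$ and which is a fusion system over $T$. For fusion systems $\mathcal E$ over $T$ and $\mathcal F$ over $S$, a morphism from $\mathcal E$ to $\mathcal F$ is a homomorphism $f\colon T\to S$ for which there is a (necessarily unique) functor $\hat f\colon\mathcal E\to\mathcal F$ with $\hat f(P)=f(P)$ for all $P\le T$ and $\hat f(\varphi)(f(x))=f(\varphi(x))$ for all $\varphi\in\mathrm{Hom}_{\mathcal E}(P,Q)$ and $x\in P$; $\mathrm{Mor}(\mathcal E,\mathcal F)$ is the set of morphisms. The direct product of fusion systems $\mathcal F_i$ over $S_i$ ($1\le i\le k$) is the fusion system over $S_1\times\cdots\times S_k$ with $\mathrm{Hom}(P,Q)=\{(\varphi_1,\dots,\varphi_k)|_P \mid \varphi_i\in\mathrm{Hom}_{\mathcal F_i}(\mathrm{pr}_i(P),\mathrm{pr}_i(Q)),\ (\varphi_1,\dots,\varphi_k)(P)\le Q\}$, $\mathrm{pr}_i$ being the projections. Fusion subsystems $\mathcal E_1,\dots,\mathcal E_k\le\mathcal F$ commute if there is a (necessarily unique) morphism $I\in\mathrm{Mor}(\mathcal E_1\times\cdots\times\mathcal E_k,\mathcal F)$ whose restriction to each factor is the inclusion. One writes $\mathcal F=\mathcal E_1\times\cdots\times\mathcal E_k$ if $\mathcal E_1,\dots,\mathcal E_k\le\mathcal F$ commute and $I$ is an isomorphism of fusion systems. A direct factor of $\mathcal F$ is a fusion subsystem $\mathcal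 E\le\mathcal F$ with $\mathcal F=\mathcal E\times\mathcal D$ for some $\mathcal D\le\mathcal F$. A fusion system $\mathcal F$ over $S$ is indecomposable if there are no commuting fusion subsystems $\mathcal E_1,\mathcal E_2\le\mathcal F$ over proper subgroups $T_1,T_2<S$ with $\mathcal F=\mathcal E_1\times\mathcal E_2$. *)

(* Defs.v *)
From HB Require Import structures.
From mathcomp Require Import all_boot.
From mathcomp Require Import boolp classical_sets functions cardinality.

Set Implicit Arguments.
Unset Strict Implicit.
Unset Printing Implicit Defensive.

Local Open Scope classical_set_scope.
Local Open Scope card_scope.
Local Open Scope group_scope.

(* Groups may be infinite (groupType), and subgroups are classical sets.      *)
(* A homomorphism P -> Q between subgroups P of gT and Q of hT is represented *)
(* by a total function gT -> hT of which only the values on P matter: two     *)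
(* functions represent the same homomorphism when they agree on P.            *)

Section Groups.
Variables (gT hT : groupType).
Implicit Types (S T P Q : set gT) (g x : gT).

Definition subgroup P : Prop := group_closed [in P].

Definition subgroup_of S P : Prop := subgroup P /\ P `<=` S.

Definition generated (A : set gT) : set gT := smallest subgroup A.

Definition setmulg P Q : set gT := [set x * y | x in P & y in Q].

Definition is_hom P (Q : set hT) (f : gT -> hT) : Prop :=
  set_fun P Q f /\ {in P &, {morph f : x y / x * y}}.

Definition is_inj P (Q : set hT) (f : gT -> hT) : Prop :=
  is_hom P Q f /\ set_inj P f.

Definition is_group_iso P (Q : set hT) (f : gT -> hT) : Prop :=
  is_hom P Q f /\ set_bij P Q f.

(* mathcomp's x ^ g is the right conjugate g^-1 * (x * g) *)
Definition lconj g x : gT := g * x * g^-1.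

Definition normalizer S Q : set gT := [set g | S g /\ lconj g @` Q = Q].

Definition lcosets P S : set (set gT) := [set [set x * y | y in P] | x in S].

End Groups.

Section DiscretePToral.
Variable p : nat.

Definition cyclic_of_order (gT : groupType) (m : nat) (C : set gT) : Prop :=
  exists x, C = generated [set x] /\ C #= `I_m.

(* C is a copy of Z/p^oo inside gT *)
Definition quasicyclic (gT : groupType) (C : set gT) : Prop :=
  exists c : nat -> set gT,
    [/\ forall n, cyclic_of_order (p ^ n.+1)%N (c n),
        forall n, c n `<=` c n.+1
      & C = \bigcup_n c n].

Definition discrete_torus (gT : groupType) (T : set gT) : Prop :=
  exists (n : nat) (hT : groupType) (C : set hT) (f : {ffun 'I_n -> hT} -> gT),
    quasicyclic C /\
    is_group_iso [set x : {ffun 'I_n -> hT} | forall i, C (x i)] T f.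

Definition discrete_p_toral (gT : groupType) (S : set gT) : Prop :=
  subgroup S /\
  exists S0 : set gT,
    [/\ subgroup_of S S0, normalizer S S0 = S, discrete_torus S0
      & exists n, lcosets S0 S #= `I_(p ^ n)%N].

End DiscretePToral.

Section ConjugationHom.
Variables (gT : groupType) (S : set gT).
Implicit Types (P Q : set gT) (f : gT -> gT).

(* Hom_S(P, Q) *)
Definition conj_hom P Q f : Prop :=
  set_fun P Q f /\ exists2 g, S g & {in P, f =1 lconj g}.

(* Aut_S(P) *)
Definition conj_aut P f : Prop := conj_hom P P f /\ is_group_iso P P f.

End ConjugationHom.

(* f and g represent mutually inverse morphisms P -> Q and Q -> P of the      *)
(* category with morphism sets Hom                                            *)
Definition inverse_isos (T : Type) (Hom : set T -> set T -> (T -> T) -> Prop)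
    (P Q : set T) (f g : T -> T) : Prop :=
  [/\ Hom P Q f, Hom Q P g, {in P, cancel f g} & {in Q, cancel g f}].

Definition iso_in (T : Type) (Hom : set T -> set T -> (T -> T) -> Prop)
    (P Q : set T) (f : T -> T) : Prop :=
  exists g, inverse_isos Hom P Q f g.

(* fshom P Q f means that f represents an element of Hom_F(P, Q); fshom_ext   *)
(* says that this only depends on the values of f on P, and fshom_obj makes   *)
(* fshom P Q empty unless P and Q are objects, so that equality of fusion     *)
(* systems in this type is equality of categories. Identities are in          *)
(* Hom_S(P, P), so fshom_conj includes them.                                  *)
Record fusion_system (gT : groupType) := FusionSystem {
  fsgroup : set gT;
  fshom :> set gT -> set gT -> (gT -> gT) -> Prop;
  fsgroupP : subgroup fsgroup;
  fshom_obj : forall P Q f, fshom P Q f ->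
    subgroup_of fsgroup P /\ subgroup_of fsgroup Q;
  fshom_ext : forall P Q f g, fshom P Q f -> {in P, g =1 f} -> fshom P Q g;
  fshom_comp : forall P Q R f g,
    fshom P Q f -> fshom Q R g -> fshom P R (g \o f);
  fshom_conj : forall P Q f,
    subgroup_of fsgroup P -> subgroup_of fsgroup Q ->
    conj_hom fsgroup P Q f -> fshom P Q f;
  fshom_inj : forall P Q f, fshom P Q f -> is_inj P Q f;
  fshom_factor : forall P Q f, fshom P Q f ->
    exists R g, [/\ R `<=` Q, iso_in fshom P R g & {in P, f =1 g}]
}.

Section FusionSystem.
Variables (gT : groupType) (F : fusion_system gT).
Implicit Types (P Q R : set gT) (x y : gT) (f : gT -> gT).

Local Notation S := (fsgroup F).

Definition conjugate_subgroups P Q : Prop := exists f, iso_in F P Q f.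

Definition conjugate_elements x y : Prop :=
  exists2 f, F (generated [set x]) (generated [set y]) f & f x = y.

Definition aut_cosets P : set (set (gT -> gT)) :=
  [set [set h : gT -> gT | exists2 a, conj_aut S P a & {in P, h =1 f \o a}]
    | f in iso_in F P P].

Definition fully_automized (p : nat) P : Prop :=
  exists n, aut_cosets P #= `I_n /\ coprime n p.

(* N_phi, for phi : Q -> P represented by f and phi^-1 by f' *)
Definition extension_control Q P f f' : set gT :=
  [set g | normalizer S Q g /\ conj_aut S P (f \o lconj g \o f')].

Definition receptive P : Prop :=
  forall Q f f', inverse_isos F Q P f f' ->
    exists2 h, F (extension_control Q P f f') S h & {in Q, h =1 f}.

Definition saturated (p : nat) : Prop :=
  (forall P, subgroup_of S P ->
    exists Q, [/\ conjugate_subgroups P Q, fully_automized p Q & receptive Q])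
  /\
  (forall (P : nat -> set gT) f,
    (forall n, subgroup_of S (P n)) -> (forall n, P n `<=` P n.+1) ->
    is_hom (\bigcup_n P n) S f -> (forall n, F (P n) S f) ->
    F (\bigcup_n P n) S f).

Definition central P : Prop :=
  subgroup_of S P /\
  forall Q R f, F Q R f ->
    exists h, [/\ F (setmulg Q P) (setmulg R P) h,
                  {in Q, h =1 f} & {in P, h =1 id}].

Definition fscenter : set gT := generated (\bigcup_(P in central) P).

Definition focal_subgroup : set gT :=
  generated [set z | exists x y,
    [/\ S x, S y, conjugate_elements x y & z = x * y^-1]].

End FusionSystem.

Definition fusion_subsystem (gT : groupType) (E F : fusion_system gT) : Prop :=
  fsgroup E `<=` fsgroup F /\ forall P Q f, E P Q f -> F P Q f.

Section Morphisms.
Variables (gT hT : groupType).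
Variables (E : fusion_system gT) (F : fusion_system hT).

(* A functor E -> F, given on objects by ob and on morphisms by ar, where     *)
(* ar P Q f represents the image of the morphism P -> Q represented by f.     *)
Definition is_functor (ob : set gT -> set hT)
    (ar : set gT -> set gT -> (gT -> gT) -> (hT -> hT)) : Prop :=
  [/\ forall P, subgroup_of (fsgroup E) P -> subgroup_of (fsgroup F) (ob P),
      forall P Q f, E P Q f -> F (ob P) (ob Q) (ar P Q f),
      forall P Q f g, E P Q f -> {in P, f =1 g} ->
        {in ob P, ar P Q f =1 ar P Q g},
      forall P, subgroup_of (fsgroup E) P -> {in ob P, ar P P id =1 id}
    & forall P Q R f g, E P Q f -> E Q R g ->
        {in ob P, ar P R (g \o f) =1 ar Q R g \o ar P Q f}].

Definition is_morphism (f : gT -> hT) : Prop :=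
  is_hom (fsgroup E) (fsgroup F) f /\
  exists2 fhat, is_functor (fun P => f @` P) fhat &
    forall P Q phi, E P Q phi ->
      {in P, forall x, fhat P Q phi (f x) = f (phi x)}.

End Morphisms.

Definition is_isomorphism (gT hT : groupType)
    (E : fusion_system gT) (F : fusion_system hT) (f : gT -> hT) : Prop :=
  is_morphism E F f /\
  exists g, [/\ is_morphism F E g, {in fsgroup E, cancel f g}
              & {in fsgroup F, cancel g f}].

Lemma subgroupP (hT : groupType) (P : set hT) :
  subgroup P <-> P 1 /\ forall x y, P x -> P y -> P (x * y^-1).
Proof.
split=> [[P1 PD]|[P1 PD]].
  split=> [|x y Px Py]; first by move: P1; rewrite inE.
  by move: (PD x y); rewrite !inE; apply.
by split=> [|x y]; rewrite !inE //; apply: PD.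
Qed.

Lemma subgroupM (hT : groupType) (P : set hT) x y :
  subgroup P -> P x -> P y -> P (x * y).
Proof.
move=> /subgroupP[P1 PD] Px Py.
have PV z : P z -> P z^-1 by move=> Pz; rewrite -[z^-1]mul1g; apply: PD.
by rewrite -[y]invgK; apply: PD => //; apply: PV.
Qed.

Lemma hom1 (hT kT : groupType) (P : set hT) (Q : set kT) f :
  subgroup P -> is_hom P Q f -> f 1 = 1.
Proof.
move=> /subgroupP[P1 _] [_ fM]; apply: (@mulgI _ (f 1)).
by rewrite -fM ?inE// !mulg1.
Qed.

Lemma hom_image_subgroup (hT kT : groupType) (P : set hT) (Q : set kT) f :
  subgroup P -> is_hom P Q f -> subgroup (f @` P).
Proof.
move=> sP hf; have f1 := hom1 sP hf; have [P1 PD] := (subgroupP P).1 sP.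
have fM x y : P x -> P y -> f (x * y) = f x * f y.
  by move=> Px Py; apply: hf.2; rewrite inE.
have PV z : P z -> P z^-1 by move=> Pz; rewrite -[z^-1]mul1g; apply: PD.
have fV x : P x -> f x^-1 = (f x)^-1.
  move=> Px; apply: (@mulgI _ (f x)).
  by rewrite -fM ?mulgV//; apply: PV.
apply/subgroupP; split; first by exists 1.
move=> _ _ [x Px <-] [y Py <-]; exists (x * y^-1); first exact: PD.
by rewrite fM ?fV//; apply: PV.
Qed.

(* The F i may live over arbitrary subgroups of one ambient group gT, which   *)
(* covers families of fusion subsystems of a given fusion system.             *)
Section DirectProduct.
Variables (gT : groupType) (k : nat) (F : 'I_k -> fusion_system gT).

Local Notation gTk := {ffun 'I_k -> gT}.
Implicit Types (P Q R : set gTk) (f g h : gTk -> gTk).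

Definition pr (i : 'I_k) : gTk -> gT := fun x => x i.

Definition dprod_group : set gTk := [set x | forall i, fsgroup (F i) (x i)].

Definition dprod_fun (phi : 'I_k -> gT -> gT) : gTk -> gTk :=
  fun x => [ffun i => phi i (x i)].

Definition dprod_hom P Q f : Prop :=
  [/\ subgroup_of dprod_group P, subgroup_of dprod_group Q, set_fun P Q f
    & exists2 phi : 'I_k -> gT -> gT,
        forall i, F i (pr i @` P) (pr i @` Q) (phi i)
      & {in P, f =1 dprod_fun phi}].

Lemma pr_image_subgroup i P :
  subgroup_of dprod_group P -> subgroup_of (fsgroup (F i)) (pr i @` P).
Proof.
move=> [sP PF]; split; last by move=> _ [x Px <-]; apply: PF.
apply: (@hom_image_subgroup _ _ P setT) => //; split => // x y _ _.
by rewrite /pr ffunE.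
Qed.

Fact dprod_groupP : subgroup dprod_group.
Proof.
apply/subgroupP; split=> [i|x y Sx Sy i].
  by rewrite ffunE; have [+ _] := (subgroupP _).1 (fsgroupP (F i)).
have [_ FD] := (subgroupP _).1 (fsgroupP (F i)).
by rewrite !ffunE; apply: FD.
Qed.

Fact dprod_hom_obj P Q f : dprod_hom P Q f ->
  subgroup_of dprod_group P /\ subgroup_of dprod_group Q.
Proof. by case. Qed.

Fact dprod_hom_ext P Q f g :
  dprod_hom P Q f -> {in P, g =1 f} -> dprod_hom P Q g.
Proof.
move=> [sP sQ fPQ [phi Fphi fE]] gf; split => //.
  by move=> x Px; rewrite gf ?inE//; apply: fPQ.
by exists phi => // x Px; rewrite gf// fE.
Qed.

Fact dprod_hom_comp P Q R f g :
  dprod_hom P Q f -> dprod_hom Q R g -> dprod_hom P R (g \o f).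
Proof.
move=> [sP sQ fPQ [phi Fphi fE]] [_ sR gQR [psi Fpsi gE]]; split => //.
  by move=> x Px; apply: gQR; apply: fPQ.
exists (fun i => psi i \o phi i) => [i|x Px].
  exact: fshom_comp (Fphi i) (Fpsi i).
rewrite /= gE; last by rewrite inE; apply: fPQ; rewrite inE in Px.
by rewrite fE//; apply/ffunP => i; rewrite !ffunE.
Qed.

Fact dprod_hom_conj P Q f :
  subgroup_of dprod_group P -> subgroup_of dprod_group Q ->
  conj_hom dprod_group P Q f -> dprod_hom P Q f.
Proof.
move=> sP sQ [fPQ [g Sg fE]]; split => //.
have fE' : {in P, f =1 dprod_fun (fun i => lconj (g i))}.
  by move=> x Px; rewrite fE//; apply/ffunP => i; rewrite !ffunE.
exists (fun i => lconj (g i)) => // i.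
apply: fshom_conj; [exact: pr_image_subgroup..|].
split; last by exists (g i).
move=> _ [x Px <-]; exists (f x); first exact: fPQ.
by rewrite fE' ?inE// /pr ffunE.
Qed.

Fact dprod_hom_inj P Q f : dprod_hom P Q f -> is_inj P Q f.
Proof.
move=> [sP sQ fPQ [phi Fphi fE]].
have prP i x : P x -> (pr i @` P) (x i) by move=> Px; exists x.
split; first (split => //).
  move=> x y /set_mem Px /set_mem Py.
  have Pxy := subgroupM sP.1 Px Py.
  rewrite !fE ?inE//; apply/ffunP => i; rewrite !ffunE.
  have [[_ phiM] _] := fshom_inj (Fphi i).
  by apply: phiM; rewrite inE; apply: prP.
move=> x y Px Py; rewrite !fE// => /ffunP xy; apply/ffunP => i.
have [_ phiI] := fshom_inj (Fphi i).
apply: phiI; rewrite ?inE; [exact: prP (set_mem Px)|exact: prP (set_mem Py)|].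
by have := xy i; rewrite !ffunE.
Qed.

Fact dprod_hom_factor P Q f : dprod_hom P Q f ->
  exists R g, [/\ R `<=` Q, iso_in dprod_hom P R g & {in P, f =1 g}].
Proof.
move=> hf; have [sP sQ fPQ [phi Fphi fE]] := hf.
have fRQ : f @` P `<=` Q by move=> _ [x Px <-]; apply: fPQ.
have sR : subgroup_of dprod_group (f @` P).
  split; last by move=> x /fRQ; apply: sQ.2.
  exact: hom_image_subgroup sP.1 (dprod_hom_inj hf).1.
have phi_iso i : exists psi, inverse_isos (F i) (pr i @` P) (pr i @` (f @` P))
    (phi i) psi.
  have [R [g [RQ [g' [Fg Fg' gK g'K]] phig]]] := fshom_factor (Fphi i).
  have RE : R = pr i @` (f @` P).
    apply/seteqP; split => y.
      move=> Ry; have [[+ _] _] := fshom_inj Fg' => /(_ y Ry)[x Px xE].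
      exists (f x); first by exists x.
      rewrite fE ?inE// /pr ffunE phig ?inE; last by exists x.
      by have := g'K y; rewrite inE -xE; apply.
    move=> [_ [x Px <-] <-]; rewrite fE ?inE// /pr ffunE phig ?inE; last by exists x.
    by have [[+ _] _] := fshom_inj Fg; apply; exists x.
  exists g'; rewrite -RE; split => //.
  - exact: fshom_ext Fg phig.
  - by move=> x Px; rewrite phig ?gK.
  - move=> y Ry; rewrite phig ?g'K// inE.
    by have [[+ _] _] := fshom_inj Fg'; apply; rewrite inE in Ry.
have [psi psiP] := choice phi_iso.
exists (f @` P), f; split => //; exists (dprod_fun psi).
have psiK : {in P, cancel f (dprod_fun psi)}.
  move=> x Px; rewrite fE//; apply/ffunP => i; rewrite !ffunE.
  have [_ _ phiK _] := psiP i; apply: phiK; rewrite inE.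
  by exists x => //; rewrite inE in Px.
split => //.
- split => //.
  by exists phi => // i; have [Fi _ _ _] := psiP i.
- split => //; first by move=> _ [x Px <-]; rewrite psiK ?inE.
  by exists psi => // i; have [_ Fi _ _] := psiP i.
- by move=> _ /set_mem[x Px <-]; rewrite psiK ?inE.
Qed.

Definition dprod : fusion_system gTk :=
  FusionSystem dprod_groupP dprod_hom_obj dprod_hom_ext dprod_hom_comp
    dprod_hom_conj dprod_hom_inj dprod_hom_factor.

Definition factor_incl (i : 'I_k) (x : gT) : gTk :=
  [ffun j => if j == i then x else 1].

End DirectProduct.

Section Factorization.
Variable gT : groupType.
Implicit Types (F : fusion_system gT).

Definition commuting_morphism F (k : nat) (E : 'I_k -> fusion_system gT)
    (I : {ffun 'I_k -> gT} -> gT) : Prop :=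
  is_morphism (dprod E) F I /\
  forall i, {in fsgroup (E i), forall x, I (factor_incl i x) = x}.

(* F = E_1 x ... x E_k *)
Definition is_product F (k : nat) (E : 'I_k -> fusion_system gT) : Prop :=
  (forall i, fusion_subsystem (E i) F) /\
  exists2 I, commuting_morphism F E I & is_isomorphism (dprod E) F I.

Definition family2 (E D : fusion_system gT) : 'I_2 -> fusion_system gT :=
  fun i => if i == ord0 then E else D.

Definition direct_factor F (E : fusion_system gT) : Prop :=
  exists D : fusion_system gT, is_product F (family2 E D).

Definition indecomposable F : Prop :=
  ~ exists E1 E2 : fusion_system gT,
      [/\ fsgroup E1 `<` fsgroup F, fsgroup E2 `<` fsgroup F
        & is_product F (family2 E1 E2)].

(* 0 < k: otherwise the trivial fusion system would also be an empty product, *)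
(* besides being indecomposable.                                              *)
Definition indecomposable_factorization F (k : nat)
    (E : 'I_k -> fusion_system gT) : Prop :=
  [/\ (0 < k)%N, is_product F E, forall i, indecomposable (E i)
    & (2 <= k)%N -> forall i, fsgroup (E i) <> [set 1]].

End Factorization.

(* Main.v *)
Require Import Defs.
From HB Require Import structures.
From mathcomp Require Import all_boot.
From mathcomp Require Import boolp classical_sets functions cardinality.

Set Implicit Arguments.
Unset Strict Implicit.
Unset Printing Implicit Defensive.

Local Open Scope classical_set_scope.
Local Open Scope group_scope.

(** A factorization of F is encoded by the endomorphisms e_i of S that project
    it onto the factors ([decomposition]).  The factors are the full
    subsystems of F on the subgroups e_i(S), so a direct factor is determined by
    its underlying subgroup, and factorizations are compared through their
    projections.

    Uniqueness.  Let e, e' and f, f' be the projections belonging to two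
    factorizations of F into two factors.  The cross term g = e' f e is an
    endomorphism of F, and g(S) is central in F.  Indeed, extend a morphism of
    the second factor e'(S) by the identity of e(S).  The images of this
    extension under f and f' combine to a morphism that still extends it and
    also fixes f(e(S)) elementwise; applying e' gives a morphism on a subgroup
    of e'(S) that extends the given one and fixes g(S) ([cross_extension]).
    An endomorphism g with central image is trivial: g(S) <= Z(F), which
    settles the case Z(F) = 1, and g takes the same value on F-conjugate
    elements, hence kills foc(F), which settles the case foc(F) = S.  So all
    cross terms vanish, that is, the projections of any two factorizations
    commute ([projections_commute]).  Therefore f restricts to a projection of
    every factor E, and when E is indecomposable it is the identity or trivial
    on E.  Two indecomposable factors then coincide as soon as one of them
    projects nontrivially to the other ([indecomposable_factor_eq]).

    Existence.  A factor that is not indecomposable can be split, so a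
    factorization with the largest number of nontrivial factors will do, once
    this number is bounded.  Let S_0 be the discrete torus in S, of index m,
    and choose a nontrivial element in each factor.  Among the m + 1 partial
    products of m consecutive chosen elements two lie in the same coset of
    S_0, so any m consecutive factors together contain a nontrivial element of
    S_0, and then an element of S_0 of order p.  Disjoint blocks of factors
    give different elements, and S_0 has only finitely many elements of order
    p ([factor_count_lt]).

    The trivial fusion system over the subgroup 1 is an indecomposable direct
    factor of F too.  So the indecomposable direct factors are the members of
    a factorization together with this trivial one, which does not change the
    product. *)

(** * Subgroups and homomorphisms *)

Section Homomorphisms.
Variables (gT hT : groupType).
Implicit Types (P : set gT) (Q : set hT) (f : gT -> hT).

Lemma subgroup1 P : subgroup P -> P 1.
Proof. by case/subgroupP. Qed.

Lemma subgroupV P x : subgroup P -> P x -> P x^-1.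
Proof. by case/subgroupP=> P1 PD Px; rewrite -[x^-1]mul1g; apply: PD. Qed.

Lemma subgroupX P x n : subgroup P -> P x -> P (x ^+ n).
Proof.
move=> sP Px; elim: n => [|n IHn]; first exact: subgroup1.
by rewrite expgS; apply: subgroupM.
Qed.

Lemma trivial_subgroup : subgroup [set 1 : gT].
Proof. by apply/subgroupP; split=> // _ _ -> ->; rewrite mulgV. Qed.

Lemma is_homI P Q f : (forall x, P x -> Q (f x)) ->
  (forall x y, P x -> P y -> f (x * y) = f x * f y) -> is_hom P Q f.
Proof. by move=> fPQ fM; split=> // x y; rewrite !inE; apply: fM. Qed.

Lemma homM P Q f x y :
  is_hom P Q f -> P x -> P y -> f (x * y) = f x * f y.
Proof. by move=> [_ fM] Px Py; apply: fM; rewrite inE. Qed.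

Lemma homV P Q f x : subgroup P -> is_hom P Q f -> P x -> f x^-1 = (f x)^-1.
Proof.
move=> sP hf Px; apply: (@mulgI _ (f x)).
by rewrite -(homM hf)//; [rewrite !mulgV (hom1 sP hf)|apply: subgroupV].
Qed.

Lemma homX P Q f x n : subgroup P -> is_hom P Q f -> P x -> f (x ^+ n) = f x ^+ n.
Proof.
move=> sP hf Px; elim: n => [|n IHn]; first exact: hom1 hf.
by rewrite !expgS (homM hf)// ?IHn//; apply: subgroupX.
Qed.

End Homomorphisms.

Lemma generated_sub (gT : groupType) (A T : set gT) :
  subgroup T -> A `<=` T -> generated A `<=` T.
Proof. by move=> sT AT; apply: smallest_sub. Qed.

Lemma subgroup_generated (gT : groupType) (A : set gT) : subgroup (generated A).
Proof.
apply/subgroupP; split=> [T [sT _]|x y Ax Ay T [sT AT]]; first exact: subgroup1.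
by apply: subgroupM => //; [apply: Ax|apply: subgroupV => //; apply: Ay].
Qed.

(** * Morphisms of a fusion system *)

Lemma choice2 (I T : Type) (A B : I -> T -> Prop) :
  (forall i, exists2 h, A i h & B i h) ->
  exists phi, forall i, A i (phi i) /\ B i (phi i).
Proof.
move=> ex; have ex' i : exists h, A i h /\ B i h by have [h] := ex i; exists h.
by have [phi phiP] := choice ex'; exists phi.
Qed.

Section FusionSystemTheory.
Variables (gT : groupType) (F : fusion_system gT).
Local Notation S := (fsgroup F).
Implicit Types (P Q R T : set gT) (f g : gT -> gT).

Lemma subgroup_of_fsgroup : subgroup_of S S.
Proof. by split=> //; apply: fsgroupP. Qed.

Lemma subgroup_of_trivial : subgroup_of S [set 1].
Proof.
by split=> [|_ ->]; [exact: trivial_subgroup|exact: subgroup1 (fsgroupP F)].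
Qed.

Lemma fshom_is_hom P Q f : F P Q f -> is_hom P Q f.
Proof. by case/fshom_inj. Qed.

Lemma fshom_in P Q f x : F P Q f -> P x -> Q (f x).
Proof. by move=> /fshom_is_hom[+ _]; apply. Qed.

Lemma fshom1 P Q f : F P Q f -> f 1 = 1.
Proof.
by move=> Ff; have [[sP _] _] := fshom_obj Ff; exact: hom1 (fshom_is_hom Ff).
Qed.

Lemma fshom_incl P Q : subgroup_of S P -> subgroup_of S Q -> P `<=` Q -> F P Q id.
Proof.
move=> sP sQ PQ; apply: fshom_conj => //; split=> //; exists 1.
  exact: subgroup1 (fsgroupP F).
by move=> x _; rewrite /lconj mul1g invg1 mulg1.
Qed.

(** The factorization axiom is what allows the target to be shrunk. *)
Lemma fshom_restrict P Q f P' Q' g : F P Q f ->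
  subgroup P' -> P' `<=` P -> subgroup_of S Q' ->
  (forall x, P' x -> g x = f x) -> (forall x, P' x -> Q' (g x)) -> F P' Q' g.
Proof.
move=> Ff sP' P'P sQ' gf gQ; have [[_ PS] sQ] := fshom_obj Ff.
have sP'S : subgroup_of S P' by split=> // x /P'P/PS.
have Ff' : F P' Q f.
  by apply: fshom_ext (fshom_comp (fshom_incl sP'S (fshom_obj Ff).1 P'P) Ff) _.
have Fg : F P' Q g by apply: fshom_ext Ff' _ => x /set_mem /gf.
have [R [h [RQ [h' [Fh Fh' hK h'K]] gh]]] := fshom_factor Fg.
have RQ' : R `<=` Q'.
  move=> y Ry; have Ph'y := fshom_in Fh' Ry.
  by rewrite -(h'K y) ?inE// -gh ?inE//; apply: gQ.
apply: fshom_ext (fshom_comp Fh (fshom_incl (fshom_obj Fh).2 sQ' RQ')) _.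
by move=> x Px /=; apply: gh.
Qed.

Lemma fs_image P f (H : is_hom S S f) : subgroup_of S P -> subgroup_of S (f @` P).
Proof.
move=> [sP PS]; split; last by move=> _ [x /PS Sx <-]; apply: H.1.
by apply: (@hom_image_subgroup _ _ P S) => //; apply: is_homI => [x /PS|x y /PS Px /PS];
  [exact: H.1|exact: homM H Px].
Qed.

End FusionSystemTheory.

(** The remaining fields are proofs, hence irrelevant. *)
Lemma fusion_system_eq (gT : groupType) (E D : fusion_system gT) :
  fsgroup E = fsgroup D -> (forall P Q f, E P Q f <-> D P Q f) -> E = D.
Proof.
case: E => S1 h1 ? ? ? ? ? ? ?; case: D => S2 h2 ? ? ? ? ? ? ? /= ES Eh.
have {}Eh : h1 = h2 by do 3![apply: funext => ?]; exact/propext/Eh.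
by subst S2 h2; congr FusionSystem; exact: Prop_irrelevance.
Qed.

(** The functor in the definition of a morphism is determined by its action on
    elements, so its existence is only a condition on each morphism of [E]. *)
Lemma is_morphismP (gT hT : groupType) (E : fusion_system gT)
    (F : fusion_system hT) (f : gT -> hT) :
  is_morphism E F f <->
  is_hom (fsgroup E) (fsgroup F) f /\
  forall P Q phi, E P Q phi ->
    exists2 psi, F (f @` P) (f @` Q) psi & forall x, P x -> psi (f x) = f (phi x).
Proof.
split=> [[hf [fhat [_ far _ _ _] fhatE]]|[hf fmor]].
  split=> // P Q phi Ephi; exists (fhat P Q phi); first exact: far.
  by move=> x Px; apply: fhatE => //; rewrite inE.
split=> //.
have ex P Q phi : exists psi, E P Q phi ->
    F (f @` P) (f @` Q) psi /\ forall x, P x -> psi (f x) = f (phi x).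
  have [/fmor[psi ? ?]|nE] := pselect (E P Q phi); first by exists psi.
  by exists (fun=> 1).
pose ar P Q phi := projT1 (cid (ex P Q phi)).
have arP P Q phi : E P Q phi -> F (f @` P) (f @` Q) (ar P Q phi) /\
    forall x, P x -> ar P Q phi (f x) = f (phi x).
  exact: (projT2 (cid (ex P Q phi))).
exists ar; last first.
  by move=> P Q phi /arP[_ arE] x /set_mem; apply: arE.
split.
- move=> P [sP PE]; split; last by move=> _ [x /PE Ex <-]; apply: hf.1.
  apply: (@hom_image_subgroup _ _ P (fsgroup F)) => //.
  by apply: is_homI => [x /PE|x y /PE Px /PE]; [exact: hf.1|exact: homM hf Px].
- by move=> P Q phi /arP[].
- move=> P Q phi psi Ephi phipsi _ /set_mem[x Px <-].
  have Epsi : E P Q psi by apply: fshom_ext Ephi _ => y Py; rewrite phipsi.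
  by rewrite (arP _ _ _ Ephi).2// (arP _ _ _ Epsi).2// phipsi ?inE.
- move=> P sP _ /set_mem[x Px <-].
  by rewrite (arP _ _ _ (fshom_incl sP sP (fun _ h => h))).2.
- move=> P Q R phi psi Ephi Epsi _ /set_mem[x Px <-] /=.
  rewrite (arP _ _ _ (fshom_comp Ephi Epsi)).2// (arP _ _ _ Ephi).2//.
  by rewrite (arP _ _ _ Epsi).2//; apply: fshom_in Ephi Px.
Qed.

Lemma morphism_comp (gT hT kT : groupType) (E : fusion_system gT)
    (F : fusion_system hT) (G : fusion_system kT) f g :
  is_morphism E F f -> is_morphism F G g -> is_morphism E G (g \o f).
Proof.
move=> /is_morphismP[hf mf] /is_morphismP[hg mg]; apply/is_morphismP; split.
  apply: is_homI => [x Ex|x y Ex Ey] /=; first by apply: hg.1; apply: hf.1.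
  by rewrite (homM hf)// (homM hg)//; apply: hf.1.
move=> P Q phi /mf[psi /mg[chi Gchi chiE] psiE]; exists chi.
  by rewrite !image_comp in Gchi.
by move=> x Px /=; rewrite chiE ?psiE//; exists x.
Qed.

(** * Full subsystems *)

Section FullSubsystems.
Variable gT : groupType.
Implicit Types (E D F : fusion_system gT) (P Q T : set gT).

Definition full_subsystem E F : Prop :=
  fusion_subsystem E F /\
  forall P Q f, F P Q f -> P `<=` fsgroup E -> Q `<=` fsgroup E -> E P Q f.

Lemma full_subsystem_refl F : full_subsystem F F.
Proof. by split; first split. Qed.

Lemma full_subsystem_eq D E F : full_subsystem D F -> full_subsystem E F ->
  fsgroup D = fsgroup E -> D = E.
Proof.
move=> [[DF homDF] fullD] [[EF homEF] fullE] DE; apply: fusion_system_eq => //.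
move=> P Q f; split=> [Df|Ef].
  by have [[_ PD] [_ QD]] := fshom_obj Df; apply: fullE; rewrite -?DE//; apply: homDF.
by have [[_ PE] [_ QE]] := fshom_obj Ef; apply: fullD; rewrite ?DE//; apply: homEF.
Qed.

Section Restriction.
Variables (F : fusion_system gT) (T : set gT).
Hypothesis sT : subgroup_of (fsgroup F) T.

Definition restr_hom P Q f := [/\ F P Q f, P `<=` T & Q `<=` T].

Fact restr_obj P Q f : restr_hom P Q f -> subgroup_of T P /\ subgroup_of T Q.
Proof. by case=> /fshom_obj[[sP _] [sQ _]] PT QT. Qed.

Fact restr_ext P Q f g : restr_hom P Q f -> {in P, g =1 f} -> restr_hom P Q g.
Proof. by move=> [Ff PT QT] gf; split=> //; apply: fshom_ext Ff gf. Qed.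

Fact restr_comp P Q R f g :
  restr_hom P Q f -> restr_hom Q R g -> restr_hom P R (g \o f).
Proof. by move=> [Ff PT QT] [Fg _ RT]; split=> //; apply: fshom_comp Ff Fg. Qed.

Fact restr_conj P Q f : subgroup_of T P -> subgroup_of T Q ->
  conj_hom T P Q f -> restr_hom P Q f.
Proof.
have TF := sT.2; move=> [sP PT] [sQ QT] [fPQ [g Tg fE]]; split=> //.
apply: fshom_conj; [by split=> // x /PT/TF|by split=> // x /QT/TF|].
by split=> //; exists g => //; apply: TF.
Qed.

Fact restr_inj P Q f : restr_hom P Q f -> is_inj P Q f.
Proof. by case=> /fshom_inj. Qed.

Fact restr_factor P Q f : restr_hom P Q f ->
  exists R g, [/\ R `<=` Q, iso_in restr_hom P R g & {in P, f =1 g}].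
Proof.
move=> [/fshom_factor[R [g [RQ [g' [Fg Fg' gK g'K]] fg]]] PT QT].
have RT : R `<=` T by move=> x /RQ/QT.
by exists R, g; split=> //; exists g'.
Qed.

Definition restriction : fusion_system gT :=
  FusionSystem sT.1 restr_obj restr_ext restr_comp restr_conj restr_inj
    restr_factor.

Lemma restriction_full : full_subsystem restriction F.
Proof. by split=> //; split=> [|P Q f []//]; apply: sT.2. Qed.

End Restriction.
End FullSubsystems.

(** * Decompositions of a fusion system *)

(** The maps [e i] are the projections of S onto the factors, seen as
    endomorphisms of S.  That S is the direct product of the [e i @` S] is
    expressed by the bijectivity of x |-> (e i x)_i and not by an equation
    between x and the product of the [e i x], so that [I] needs no order and
    can be any type.  With [proj_mor] each morphism of F has components, and
    [proj_glue] is the converse. *)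
Record decomposition (gT : groupType) (F : fusion_system gT) (I : Type)
    (e : I -> gT -> gT) : Prop := Decomposition {
  proj_mor : forall i, is_morphism F F (e i);
  proj_idem : forall i x, fsgroup F x -> e i (e i x) = e i x;
  proj_orth : forall i j x, i <> j -> fsgroup F x -> e i (e j x) = 1;
  proj_inj : forall x y, fsgroup F x -> fsgroup F y ->
    (forall i, e i x = e i y) -> x = y;
  proj_surj : forall t, (forall i, fsgroup F (t i)) ->
    exists2 x, fsgroup F x & forall i, e i x = e i (t i);
  proj_glue : forall P Q f,
    subgroup_of (fsgroup F) P -> subgroup_of (fsgroup F) Q -> set_fun P Q f ->
    (forall i, exists2 h, F (e i @` P) (e i @` Q) h
                        & forall x, P x -> h (e i x) = e i (f x)) ->
    F P Q f
}.

Section DecompositionTheory.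
Variables (gT : groupType) (F : fusion_system gT) (I : Type).
Variable e : I -> gT -> gT.
Hypothesis De : decomposition F e.
Local Notation S := (fsgroup F).
Implicit Types (P Q : set gT) (x y : gT) (i j : I).

Lemma proj_hom i : is_hom S S (e i).
Proof. by case/is_morphismP: (proj_mor De i). Qed.

Lemma projS i x : S x -> S (e i x).
Proof. by move=> Sx; apply: (proj_hom i).1. Qed.

Lemma projM i x y : S x -> S y -> e i (x * y) = e i x * e i y.
Proof. exact: homM (proj_hom i). Qed.

Lemma proj1 i : e i 1 = 1.
Proof. exact: hom1 (fsgroupP F) (proj_hom i). Qed.

Lemma proj_fun i P Q f : F P Q f ->
  exists2 h, F (e i @` P) (e i @` Q) h & forall x, P x -> h (e i x) = e i (f x).
Proof. by case/is_morphismP: (proj_mor De i) => _; apply. Qed.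

Lemma proj_fix i x : (e i @` S) x -> e i x = x.
Proof. by case=> y Sy <-; apply: (proj_idem De). Qed.

Lemma proj_kill i j x : i <> j -> (e j @` S) x -> e i x = 1.
Proof. by move=> ij [y Sy <-]; apply: (proj_orth De). Qed.

Lemma subgroup_of_proj i P : subgroup_of S P -> subgroup_of S (e i @` P).
Proof. exact: fs_image (proj_hom i). Qed.

Lemma subgroup_of_factor i : subgroup_of S (e i @` S).
Proof. exact: subgroup_of_proj (subgroup_of_fsgroup F). Qed.

Lemma factor_sub i : e i @` S `<=` S.
Proof. by case: (subgroup_of_factor i). Qed.

Definition box (P : I -> set gT) : set gT := [set x | S x /\ forall i, P i (e i x)].

Lemma subgroup_of_box (P : I -> set gT) :
  (forall i, subgroup (P i)) -> subgroup_of S (box P).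
Proof.
move=> sP; split; last by move=> x [].
have sS := fsgroupP F; apply/subgroupP; split.
  by split=> [|i]; [exact: subgroup1|rewrite proj1; exact: subgroup1].
move=> x y [Sx Px] [Sy Py]; have Sy' := subgroupV sS Sy.
split=> [|i]; first exact: subgroupM.
rewrite projM// (homV sS (proj_hom i))//; apply: subgroupM => //.
exact: subgroupV.
Qed.

Lemma proj_box (P : I -> set gT) i : (forall j, subgroup (P j)) ->
  P i `<=` e i @` S -> e i @` box P = P i.
Proof.
move=> sP PeS; apply/seteqP; split=> [_ [x [_ Px] <-]//|x Px].
have ex := proj_fix (PeS _ Px); exists x => //; split=> [|j].
  by apply: (factor_sub (i := i)); apply: PeS.
have [<-|ij] := pselect (i = j); first by rewrite ex.
by rewrite (proj_kill (j := i))//; [exact: subgroup1|exact: nesym|exact: PeS].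
Qed.

Lemma joint_value (t : I -> gT) : (forall i, (e i @` S) (t i)) ->
  exists2 x, S x & forall i, e i x = t i.
Proof.
move=> et; have [i|x Sx xE] := proj_surj De (t := t); first exact: factor_sub.
by exists x => // i; rewrite xE proj_fix.
Qed.

(** Gluing morphisms of the factors on the largest subgroup on which the
    result can be defined.  A subgroup is contained in the box of its
    projections, so this also gives extensions of morphisms of F. *)
Lemma box_hom (P Q : I -> set gT) (phi : I -> gT -> gT) :
  (forall i, P i `<=` e i @` S) -> (forall i, Q i `<=` e i @` S) ->
  (forall i, F (P i) (Q i) (phi i)) ->
  exists2 Phi, F (box P) (box Q) Phi &
    forall x i, box P x -> e i (Phi x) = phi i (e i x).
Proof.
move=> PS QS Fphi.
have sP i : subgroup (P i) by have [[]] := fshom_obj (Fphi i).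
have sQ i : subgroup (Q i) by have [_ []] := fshom_obj (Fphi i).
have ex x : exists y, box P x -> S y /\ forall i, e i y = phi i (e i x).
  have [[Sx Px]|nP] := pselect (box P x); last by exists 1.
  have [i|y Sy yE] := @joint_value (fun i => phi i (e i x)).
    by apply: QS; apply: fshom_in (Fphi i) (Px i).
  by exists y.
have [Phi PhiP] := choice ex.
exists Phi; last by move=> x i /PhiP[].
apply: (proj_glue De) => [||x Px|i]; [exact: subgroup_of_box..| |].
  have [Sy yE] := PhiP x Px; split=> // i; rewrite yE.
  by apply: fshom_in (Fphi i) _; apply: Px.2.
rewrite !proj_box//; exists (phi i) => // x Px.
by rewrite (PhiP x Px).2.
Qed.

End DecompositionTheory.

Section NewDecompositions.
Variables (gT : groupType) (F : fusion_system gT).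
Local Notation S := (fsgroup F).

Lemma decomposition_reindex (I J : Type) (e : I -> gT -> gT) (s : J -> I) :
  bijective s -> decomposition F e -> decomposition F (e \o s).
Proof.
move=> [t sK tK] De; split.
- by move=> j; apply: (proj_mor De).
- by move=> j x; apply: (proj_idem De).
- by move=> j j' x jj'; apply: (proj_orth De) => /(can_inj sK).
- by move=> x y Sx Sy exy; apply: (proj_inj De) => // i; rewrite -(tK i); apply: exy.
- move=> u Su; have [i|x Sx xE] := proj_surj De (t := u \o t); first exact: Su.
  by exists x => // j /=; rewrite xE /= sK.
- move=> P Q f sP sQ fPQ fcomp; apply: (proj_glue De) => // i.
  by rewrite -(tK i); apply: fcomp.
Qed.

Lemma decomposition_id (I : Type) (i0 : I) :
  (forall i, i = i0) -> decomposition F (fun _ : I => id).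
Proof.
move=> Ii0; have H (P : set gT) : id @` P = P by rewrite image_id.
split=> //.
- move=> i; apply/is_morphismP; split; first exact: is_homI.
  by move=> P Q f Ff; exists f => //; rewrite !H.
- by move=> i j x /(_ _)[]; rewrite (Ii0 i) (Ii0 j).
- by move=> x y _ _ /(_ i0).
- by move=> t St; exists (t i0) => // i; rewrite (Ii0 i).
- move=> P Q f sP sQ fPQ /(_ i0)[h]; rewrite !H => Fh hE.
  by apply: fshom_ext Fh _ => x /set_mem Px; rewrite hE.
Qed.

(** The factors are grouped into two according to [X]; the components of a
    morphism on each side are glued from its components on the single
    factors. *)
Lemma decomposition_coarsen (I : Type) (e : I -> gT -> gT) (X : I -> bool) :
  decomposition F e ->
  exists2 d : bool -> gT -> gT, decomposition F d &
    forall b i x, S x -> e i (d b x) = if X i == b then e i x else 1.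
Proof.
move=> De; have S1 := subgroup1 (fsgroupP F).
have ex (bx : bool * gT) : exists y, S bx.2 ->
    S y /\ forall i, e i y = if X i == bx.1 then e i bx.2 else 1.
  case: bx => b x /=; have [Sx|nS] := pselect (S x); last by exists 1.
  have [i|y Sy yE] := joint_value De (t := fun i => if X i == b then e i x else 1).
    by case: ifP => _; [exists x|exists 1; rewrite ?(proj1 De)].
  by exists y.
have [d' d'P] := choice ex; pose d b x := d' (b, x).
have dS b x : S x -> S (d b x) by move=> /(d'P (b, x))[].
have edE b i x : S x -> e i (d b x) = if X i == b then e i x else 1.
  by move=> /(d'P (b, x))[].
exists d => //.
have einj := proj_inj De.
have hd b : is_hom S S (d b).
  apply: is_homI => [x|x y Sx Sy]; first exact: dS.
  have Sxy := subgroupM (fsgroupP F) Sx Sy.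
  apply: einj => [||i]; [exact: dS|by apply: subgroupM (fsgroupP F) _ _; apply: dS|].
  rewrite (projM De)//; [|exact: dS..].
  by rewrite !edE//; case: ifP; rewrite ?mulg1// (projM De).
have edP b i P : subgroup_of S P ->
    e i @` (d b @` P) = if X i == b then e i @` P else [set 1].
  move=> [sP PS]; rewrite image_comp.
  case: ifP => Xib; apply/seteqP; split.
  - by move=> _ [x Px <-] /=; rewrite edE ?Xib; [exists x|exact: PS].
  - by move=> _ [x Px <-]; exists x => //=; rewrite edE ?Xib//; apply: PS.
  - by move=> _ [x Px <-] /=; rewrite edE ?Xib//; apply: PS.
  - move=> _ ->; exists 1; first exact: subgroup1.
    by rewrite /= edE ?Xib//.
split.
- move=> b; apply/is_morphismP; split=> // P Q f Ff.
  have [sP sQ] := fshom_obj Ff.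
  have [h hP] := choice2 (fun i => proj_fun De i Ff).
  pose R P i := if X i == b then e i @` P else [set 1].
  have R_sub P' i : subgroup_of S P' -> R P' i `<=` e i @` S.
    move=> [_ P'S]; rewrite /R; case: ifP => _.
      by move=> _ [x /P'S Sx <-]; exists x.
    by move=> _ ->; exists 1; rewrite ?(proj1 De).
  have [i|i|i|Phi FPhi PhiE] :=
      box_hom De (P := R P) (Q := R Q) (phi := fun i => if X i == b then h i else id).
  + exact: R_sub.
  + exact: R_sub.
  + rewrite /R; case: ifP => _; first by have [] := hP i.
    by apply: fshom_incl => //; apply: subgroup_of_trivial.
  have dbox x : P x -> box F e (R P) (d b x).
    move=> Px; split=> [|i]; first by apply: dS; apply: sP.2.
    by rewrite /R edE; [case: ifP => // _; exists x|exact: sP.2].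
  have PhiE' x : P x -> Phi (d b x) = d b (f x).
    move=> Px; have Sx := sP.2 _ Px; have Sfx := sQ.2 _ (fshom_in Ff Px).
    apply: einj => [||i].
    * by have /fshom_in/(_ (dbox _ Px))[] := FPhi.
    * exact: dS.
    rewrite PhiE; last exact: dbox.
    by rewrite !edE//; case: ifP => // _; apply: (hP i).2.
  exists Phi => //; apply: (fshom_restrict FPhi) => //.
  + by have [] := fs_image (hd b) sP.
  + by move=> _ [x /dbox ? <-].
  + exact: fs_image (hd b) sQ.
  + by move=> _ [x Px <-]; rewrite PhiE'//; exists (f x) => //; apply: fshom_in Ff Px.
- move=> b x Sx; apply: einj => [||i]; [exact/dS/dS|exact: dS|].
  by rewrite edE ?edE//; [case: (X i == b)|exact: dS].
- move=> b b' x bb' Sx; apply: einj => [||i]; [exact/dS/dS|exact: S1|].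
  rewrite edE; last exact: dS.
  rewrite edE// (proj1 De); case: eqP => // ->; case: eqP => //.
- move=> x y Sx Sy dxy; apply: einj => // i.
  by have := congr1 (e i) (dxy (X i)); rewrite !edE// eqxx.
- move=> t St; have [i|x Sx xE] := proj_surj De (t := fun i => t (X i)).
    exact: St.
  exists x => // b; apply: einj => [||i]; [exact: dS..|].
  by rewrite !edE//; case: eqP => // <-.
- move=> P Q f sP sQ fPQ fd; apply: (proj_glue De) => // i.
  have [h Fh hE] := fd (X i).
  have [h' Fh' h'E] := proj_fun De i Fh.
  move: Fh'; rewrite !edP// eqxx => Fh'; exists h' => // x Px.
  have /h'E : (d (X i) @` P) (d (X i) x) by exists x.
  rewrite hE// !edE ?eqxx//; [by apply: sQ.2; apply: fPQ|exact: sP.2].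
Qed.

End NewDecompositions.

Section BinaryDecompositions.
Variables (gT : groupType) (F : fusion_system gT) (f : bool -> gT -> gT).
Hypothesis Df : decomposition F f.
Local Notation S := (fsgroup F).

Lemma binary_join x b : S x -> x = f b x * f (~~ b) x.
Proof.
move=> Sx; have fS c := projS Df c Sx.
apply: (proj_inj Df) => // [|c]; first exact: subgroupM (fsgroupP F) _ _.
rewrite (projM Df)//.
have orth (d : bool) : f d (f (~~ d) x) = 1.
  by apply: (proj_orth Df) => //; case: d.
have orth' (d : bool) : f (~~ d) (f d x) = 1.
  by apply: (proj_orth Df) => //; case: d.
have [->|->] : c = b \/ c = ~~ b by case: c b => -[]; [left|right|right|left].
  by rewrite (proj_idem Df)// orth mulg1.
by rewrite (proj_idem Df)// orth' mul1g.
Qed.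

(** As x is the product of its projections, stability of [fsgroup E] under
    [f] makes it the product of its intersections with the two factors. *)
Lemma decomposition_restrict (E : fusion_system gT) :
  full_subsystem E F -> (forall b x, fsgroup E x -> fsgroup E (f b x)) ->
  decomposition E f.
Proof.
move=> [[ES EF] fullE] fE.
have imE b P : P `<=` fsgroup E -> f b @` P `<=` fsgroup E.
  by move=> PE _ [x /PE Ex <-]; apply: fE.
split.
- move=> b; apply/is_morphismP; split.
    apply: is_homI => [x|x y /ES Sx /ES Sy]; [exact: fE|exact: (projM Df)].
  move=> P Q h Eh; have [[_ PE] [_ QE]] := fshom_obj Eh.
  have [g Fg gE] := proj_fun Df b (EF _ _ _ Eh).
  by exists g => //; apply: fullE => //; apply: imE.
- by move=> b x /ES; apply: (proj_idem Df).
- by move=> b b' x bb' /ES; apply: (proj_orth Df).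
- by move=> x y /ES Sx /ES; apply: (proj_inj Df).
- move=> t Et; have [b|x Sx xE] := proj_surj Df (t := t); first exact/ES.
  exists x => //; rewrite (binary_join true Sx) !xE.
  by apply: subgroupM (fsgroupP E) _ _; apply: fE.
- move=> P Q h [sP PE] [sQ QE] hPQ hf; apply: fullE => //.
  apply: (proj_glue Df) => // [||b]; [by split=> // x /PE/ES|by split=> // x /QE/ES|].
  by have [g /EF Fg gE] := hf b; exists g.
Qed.

End BinaryDecompositions.

(** The sigma type indexes all factors of the factors; gluing is done in two
    stages, first inside each [E i] and then in F. *)
Lemma decomposition_refine (gT : groupType) (F : fusion_system gT) (I : Type)
    (e : I -> gT -> gT) (E : I -> fusion_system gT) (J : I -> Type)
    (a : forall i, J i -> gT -> gT) :
  decomposition F e ->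
  (forall i, full_subsystem (E i) F /\ fsgroup (E i) = e i @` fsgroup F) ->
  (forall i, decomposition (E i) (@a i)) ->
  decomposition F (fun k : {i & J i} => a (tag k) (tagged k) \o e (tag k)).
Proof.
move=> De EP Da.
have ET i x : fsgroup F x -> fsgroup (E i) (e i x).
  by move=> Sx; rewrite (EP i).2; exists x.
have ES i x : fsgroup (E i) x -> fsgroup F x by apply: (EP i).1.1.1.
have ea i j x : fsgroup F x -> e i (a i j (e i x)) = a i j (e i x).
  move=> Sx; apply: (proj_fix De); rewrite -(EP i).2.
  by apply: (projS (Da i)); apply: ET.
have homEF i P Q f : E i P Q f -> F P Q f by apply: (EP i).1.1.2.
have e_in i P Q f : subgroup_of (fsgroup F) P -> subgroup_of (fsgroup F) Q ->
    F (e i @` P) (e i @` Q) f -> E i (e i @` P) (e i @` Q) f.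
  move=> [_ PS] [_ QS] Ff; apply: (EP i).1.2 => //.
    by move=> _ [x /PS Sx <-]; apply: ET.
  by move=> _ [x /QS Sx <-]; apply: ET.
split.
- case=> i j /=; apply/is_morphismP; split.
    apply: is_homI => [x Sx|x y Sx Sy] /=.
      by apply: (ES i); apply: (projS (Da i)); apply: ET.
    by rewrite (projM De)// (projM (Da i)); first by []; apply: ET.
  move=> P Q f Ff; have [sP sQ] := fshom_obj Ff.
  have [h /(e_in _ _ _ _ sP sQ) Eh hE] := proj_fun De i Ff.
  have [g Eg gE] := proj_fun (Da i) j Eh; rewrite !image_comp in Eg.
  exists g; first exact: (homEF i).
  by move=> x Px /=; rewrite gE ?hE//; exists x.
- by case=> i j x Sx /=; rewrite ea// (proj_idem (Da i))//; apply: ET.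
- case=> i j [i' j'] x /= ij Sx; have [ii'|ii'] := pselect (i = i').
    subst i'; rewrite ea//; apply: (proj_orth (Da i)); last exact: ET.
    by move=> jj'; apply: ij; rewrite jj'.
  have aS := projS (Da i') j' (ET i' x Sx).
  have -> : e i (a i' j' (e i' x)) = 1.
    by apply: (proj_kill De ii'); rewrite -(EP i').2.
  exact: (proj1 (Da i)).
- move=> x y Sx Sy xy; apply: (proj_inj De) => // i.
  apply: (proj_inj (Da i)) => [||j]; [exact: ET..|].
  exact: (xy (Tagged J j)).
- move=> t St; have ex i : exists x, fsgroup (E i) x /\
      forall j, a i j x = a i j (e i (t (Tagged J j))).
    have [j|x Ex xE] := proj_surj (Da i) (t := fun j => e i (t (Tagged J j))).
      exact: ET.
    by exists x.
  have [u uP] := choice ex; have [i|x Sx xE] := joint_value De (t := u).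
    by rewrite -(EP i).2; have [] := uP i.
  exists x => // -[i j] /=; rewrite xE; exact: (uP i).2.
- move=> P Q f sP sQ fPQ fc; apply: (proj_glue De) => // i.
  pose R P j := a i j @` (e i @` P).
  have hex j : exists2 h, F ((a i j \o e i) @` P) ((a i j \o e i) @` Q) h &
      forall x, P x -> h (a i j (e i x)) = a i j (e i (f x)).
    exact: fc (Tagged J j).
  have [h hP] := choice2 hex.
  have eE P' : subgroup_of (fsgroup F) P' -> e i @` P' `<=` fsgroup (E i).
    by move=> [_ P'S] _ [x /P'S Sx <-]; apply: ET.
  have R_sub P' j : subgroup_of (fsgroup F) P' -> R P' j `<=` a i j @` fsgroup (E i).
    by move=> sP' _ [x /(eE _ sP') Ex <-]; exists x.
  have [j|j|j|Phi EPhi PhiE] := box_hom (Da i) (P := R P) (Q := R Q) (phi := h).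
  + exact: R_sub.
  + exact: R_sub.
  + apply: (EP i).1.2.
    * by rewrite /R !image_comp; have [] := hP j.
    * by move=> x /(R_sub _ j sP); apply: (factor_sub (Da i)).
    * by move=> x /(R_sub _ j sQ); apply: (factor_sub (Da i)).
  have ebox x : P x -> box (E i) (@a i) (R P) (e i x).
    move=> Px; split=> [|j]; first by apply: ET; apply: sP.2.
    by exists (e i x) => //; exists x.
  have PhiE' x : P x -> Phi (e i x) = e i (f x).
    move=> Px; apply: (proj_inj (Da i)) => [||j].
    * by have /fshom_in/(_ (ebox _ Px))[] := EPhi.
    * by apply: ET; apply: sQ.2; apply: fPQ.
    by rewrite PhiE ?(hP j).2//; apply: ebox.
  exists Phi => //; apply: (fshom_restrict (homEF _ _ _ _ EPhi)) => //.
  + by have [] := subgroup_of_proj De i sP.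
  + by move=> _ [x /ebox ? <-].
  + exact: (subgroup_of_proj De i sQ).
  + by move=> _ [x Px <-]; rewrite PhiE'//; exists (f x) => //; apply: fPQ.
Qed.

(** * Products and decompositions *)

Section Products.
Variables (gT : groupType) (F : fusion_system gT) (k : nat).
Variable E : 'I_k -> fusion_system gT.
Local Notation S := (fsgroup F).

(** The projections are the coordinates of the inverse of the product
    isomorphism.  The factors are full because a morphism of F between
    subgroups of the i-th factor coincides with its own i-th component, and the
    components of a morphism in the product belong to the [E j]. *)
Lemma product_decomposition : is_product F E -> exists2 e,
  decomposition F e & forall i, full_subsystem (E i) F /\ fsgroup (E i) = e i @` S.
Proof.
case=> EF [I [_ Iincl] [/is_morphismP[hI mI] [J [/is_morphismP[hJ mJ] IK JK]]]].
have {}IK u : dprod_group E u -> J (I u) = u by move=> Eu; rewrite IK ?inE.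
have {}JK x : S x -> I (J x) = x by move=> Sx; rewrite JK ?inE.
pose e i x := J x i.
have inclE i x : fsgroup (E i) x -> J x = factor_incl i x.
  move=> Ex; rewrite -[in LHS](Iincl i x) ?inE// IK// => j.
  by rewrite ffunE; case: eqP => [->//|_]; apply: subgroup1 (fsgroupP _).
have eE i x : S x -> fsgroup (E i) (e i x) by move=> Sx; apply: hJ.1.
have ES i x : fsgroup (E i) x -> S x by apply: (EF i).1.
have e_fix i x : fsgroup (E i) x -> e i x = x.
  by move=> Ex; rewrite /e (inclE i)// ffunE eqxx.
have eS i : fsgroup (E i) = e i @` S.
  apply/seteqP; split=> [x Ex|_ [x Sx <-]]; last exact: eE.
  by exists x; [exact: ES Ex|exact: e_fix].
have prJ i P : pr i @` (J @` P) = e i @` P by rewrite image_comp.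
have comps P Q f : F P Q f -> exists2 phi : 'I_k -> gT -> gT,
    forall i, E i (e i @` P) (e i @` Q) (phi i) &
    forall i x, P x -> phi i (e i x) = e i (f x).
  move=> /mJ[psi [_ _ _ [phi Ephi psiE]] psiJ]; exists phi => [i|i x Px].
    by have := Ephi i; rewrite !prJ.
  by rewrite /e -psiJ// psiE ?ffunE// inE; exists x.
have fullE i : full_subsystem (E i) F.
  split=> // P Q f Ff PE QE; have [phi /(_ i) Ephi phiE] := comps _ _ _ Ff.
  have eP P' : P' `<=` fsgroup (E i) -> e i @` P' = P'.
    move=> P'E; apply/seteqP; split=> [_ [x Px <-]|x Px].
      by rewrite e_fix//; apply: P'E.
    by exists x => //; apply: e_fix; apply: P'E.
  rewrite !eP// in Ephi; apply: fshom_ext Ephi _ => x /set_mem Px.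
  have := phiE i x Px; rewrite (e_fix i x) ?(e_fix i (f x))//; last exact: PE.
  by apply: QE; apply: fshom_in Ff Px.
exists e => //; split.
- move=> i; apply/is_morphismP; split.
    apply: is_homI => [x /(eE i)|x y Sx Sy]; first exact: ES.
    by rewrite /e (homM hJ)// ffunE.
  move=> P Q f /comps[phi Ephi phiE]; exists (phi i); first exact: (EF i).2.
  exact: phiE.
- by move=> i x Sx; apply: e_fix; apply: eE.
- move=> i j x ij Sx; rewrite {1}/e (inclE j) ?ffunE; last exact: eE.
  by case: eqP.
- move=> x y Sx Sy xy; rewrite -(JK x)// -(JK y)//; congr I.
  by apply/ffunP => i; apply: xy.
- move=> t St; pose u := [ffun i => e i (t i)].
  have Eu : dprod_group E u by move=> i; rewrite ffunE; apply: eE.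
  exists (I u); first exact: hI.1.
  by move=> i; rewrite /e IK// ffunE.
- move=> P Q f sP sQ fPQ fc.
  have [phi phiP] := choice2 fc.
  have Ephi i : E i (e i @` P) (e i @` Q) (phi i).
    apply: (fullE i).2; first by have [] := phiP i.
      by move=> _ [x Px <-]; apply: eE; apply: sP.2.
    by move=> _ [x Px <-]; apply: eE; apply: sQ.2.
  have phiJ x : P x -> dprod_fun phi (J x) = J (f x).
    by move=> Px; apply/ffunP => i; rewrite !ffunE; apply: (phiP i).2.
  have sJ P' : subgroup_of S P' -> subgroup_of (dprod_group E) (J @` P').
    move=> [sP' P'S]; split; last by move=> _ [x Px <-]; apply: hJ.1; apply: P'S.
    apply: (@hom_image_subgroup _ _ P' (dprod_group E)) => //.
    apply: is_homI => [x /P'S|x y /P'S Sx /P'S Sy]; first exact: hJ.1.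
    exact: (homM hJ).
  have Dphi : dprod E (J @` P) (J @` Q) (dprod_fun phi).
    split; [exact: sJ|exact: sJ| |by exists phi => // i; rewrite !prJ].
    by move=> _ [x Px <-]; rewrite phiJ//; exists (f x) => //; apply: fPQ.
  have [h Fh hE] := mI _ _ _ Dphi.
  have IJ P' : subgroup_of S P' -> I @` (J @` P') = P'.
    move=> [_ P'S]; rewrite image_comp; apply/seteqP; split.
      by move=> _ [x Px <-] /=; rewrite JK//; apply: P'S.
    by move=> x Px; exists x => //=; rewrite JK//; apply: P'S.
  rewrite !IJ// in Fh; apply: fshom_ext Fh _ => x /set_mem Px.
  have Sfx : S (f x) by apply: sQ.2; apply: fPQ.
  by have := hE (J x); rewrite phiJ// (JK x (sP.2 _ Px)) JK// => ->//; exists x.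
Qed.

Lemma decomposition_product e : decomposition F e ->
  (forall i, full_subsystem (E i) F /\ fsgroup (E i) = e i @` S) -> is_product F E.
Proof.
move=> De EP; have EF i := (EP i).1.1.
have eE i x : S x -> fsgroup (E i) (e i x) by move=> Sx; rewrite (EP i).2; exists x.
have ES i x : fsgroup (E i) x -> S x by apply: (EF i).1.
have e_fix i x : fsgroup (E i) x -> e i x = x.
  by rewrite (EP i).2; apply: proj_fix.
pose J x : {ffun 'I_k -> gT} := [ffun i => e i x].
have ex u : exists x, dprod_group E u -> S x /\ forall i, e i x = u i.
  have [Eu|nE] := pselect (dprod_group E u); last by exists 1.
  have [i|x Sx xE] := joint_value De (t := u); last by exists x.
  by rewrite -(EP i).2; apply: Eu.
have [I IP] := choice ex.
have IS u : dprod_group E u -> S (I u) by case/IP.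
have eI i u : dprod_group E u -> e i (I u) = u i by case/IP.
have JE x : S x -> dprod_group E (J x) by move=> Sx i; rewrite ffunE; apply: eE.
have IK u : dprod_group E u -> J (I u) = u.
  by move=> Eu; apply/ffunP => i; rewrite ffunE eI.
have JK x : S x -> I (J x) = x.
  move=> Sx; apply: (proj_inj De) => // [|i]; first by apply: IS; apply: JE.
  by rewrite eI ?ffunE//; apply: JE.
have sDE := dprod_groupP E.
have eIP i P : P `<=` dprod_group E -> e i @` (I @` P) = pr i @` P.
  move=> PE; rewrite image_comp; apply: eq_imagel => u /PE Eu /=.
  exact: eI.
have prJ i P : pr i @` (J @` P) = e i @` P.
  by rewrite image_comp; apply: eq_imagel => x _; rewrite /pr /= ffunE.
have hI : is_hom (dprod_group E) S I.
  apply: is_homI => [u|u v Eu Ev]; first exact: IS.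
  have Euv := subgroupM sDE Eu Ev; have Iu := IS _ Eu; have Iv := IS _ Ev.
  apply: (proj_inj De) => [||i]; [exact: IS|exact: subgroupM (fsgroupP F) _ _|].
  by rewrite (projM De)// !eI// ffunE.
have hJ : is_hom S (dprod_group E) J.
  apply: is_homI => [x|x y Sx Sy]; first exact: JE.
  by apply/ffunP => i; rewrite !ffunE (projM De).
have mI : is_morphism (dprod E) F I.
  apply/is_morphismP; split=> // P Q f Df.
  have [[sP PE] [sQ QE] fPQ [phi Ephi fE]] := Df.
  exists (I \o f \o J); last by move=> u /PE Eu /=; rewrite IK.
  have sI P' : subgroup_of (dprod_group E) P' -> subgroup_of S (I @` P').
    move=> [sP' P'E]; split; last by move=> _ [u Pu <-]; apply: IS; apply: P'E.
    apply: (@hom_image_subgroup _ _ P' S) => //.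
    apply: is_homI => [u /P'E|u v /P'E Eu /P'E Ev]; first exact: hI.1.
    exact: (homM hI).
  apply: (proj_glue De) => [|||i]; [exact: sI|exact: sI| |].
    by move=> _ [u Pu <-] /=; rewrite IK; [exists (f u) => //; apply: fPQ|exact: PE].
  rewrite !eIP//; exists (phi i); first exact: (EF i).2.
  move=> _ [u Pu <-] /=; have Eu := PE _ Pu; have Efu := QE _ (fPQ _ Pu).
  by rewrite IK// !eI// fE ?inE// ffunE.
have mJ : is_morphism F (dprod E) J.
  apply/is_morphismP; split=> // P Q f Ff; have [sP sQ] := fshom_obj Ff.
  have [phi phiP] := choice2 (fun i => proj_fun De i Ff).
  have phiJ x : P x -> dprod_fun phi (J x) = J (f x).
    by move=> Px; apply/ffunP => i; rewrite !ffunE; apply: (phiP i).2.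
  have sJ P' : subgroup_of S P' -> subgroup_of (dprod_group E) (J @` P').
    move=> [sP' P'S]; split; last by move=> _ [x Px <-]; apply: JE; apply: P'S.
    apply: (@hom_image_subgroup _ _ P' (dprod_group E)) => //.
    apply: is_homI => [x /P'S|x y /P'S Sx /P'S Sy]; first exact: hJ.1.
    exact: (homM hJ).
  exists (dprod_fun phi) => //; split; [exact: sJ|exact: sJ| |].
    by move=> _ [x Px <-]; rewrite phiJ//; exists (f x) => //; apply: fshom_in Ff Px.
  exists phi => // i; rewrite !prJ; apply: (EP i).1.2; first by have [] := phiP i.
    by move=> _ [x Px <-]; apply: eE; apply: sP.2.
  by move=> _ [x Px <-]; apply: eE; apply: sQ.2.
split=> //; exists I.
  split=> // i x /set_mem Ex.
  have Ei : dprod_group E (factor_incl i x).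
    by move=> j; rewrite ffunE; case: eqP => [->//|_]; apply: subgroup1 (fsgroupP _).
  apply: (proj_inj De) => [||j]; [exact: IS|exact: ES Ex|].
  rewrite eI// ffunE; case: eqP => [->|ji]; first by rewrite e_fix.
  by rewrite (proj_kill De ji) // -(EP i).2.
split=> //; exists J; split=> // [u /set_mem|x /set_mem]; [exact: IK|exact: JK].
Qed.

End Products.

(** * Projections of two decompositions *)

Section CrossTerms.
Variables (gT : groupType) (F : fusion_system gT).
Variables e f : bool -> gT -> gT.
Hypotheses (De : decomposition F e) (Df : decomposition F f).
Local Notation S := (fsgroup F).
Variable c : bool.

Let g := e false \o f c \o e true.

Lemma cross_mor : is_morphism F F g.
Proof.
apply: morphism_comp (proj_mor De true) _.
exact: morphism_comp (proj_mor Df c) (proj_mor De false).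
Qed.

(** The image of [g] is central up to the choice of the subgroups on which
    the extension is defined. *)
Lemma cross_extension Q R phi : F Q R phi -> exists A B h,
  [/\ F A B h, Q `<=` A, g @` S `<=` A, forall x, Q x -> h x = phi x
    & forall x, (g @` S) x -> h x = x].
Proof.
move=> Fphi; have [sQ sR] := fshom_obj Fphi.
have S1 := subgroup1 (fsgroupP F).
have eS := projS De; have fS := projS Df; have sS := subgroup_of_fsgroup F.
have eet := proj_idem De.
have orth b x : S x -> e b (e (~~ b) x) = 1.
  by move=> Sx; apply: (proj_orth De) => //; case: b.
have [phi1 Fphi1 phi1E] := proj_fun De true Fphi.
have [phi2 Fphi2 phi2E] := proj_fun De false Fphi.
have esub b P : P `<=` S -> e b @` P `<=` e b @` S.
  by move=> PS _ [x /PS Sx <-]; exists x.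
(* Phi is the second component of phi, extended by the identity of the first
   factor. *)
pose M P b := if b then e b @` S else e b @` P.
have [b|b|b|Phi FPhi PhiE] :=
    box_hom De (P := M Q) (Q := M R) (phi := fun b : bool => if b then id else phi2).
- by case: b; [|apply: esub; apply: sQ.2].
- by case: b; [|apply: esub; apply: sR.2].
- by case: b => //; apply: fshom_incl => //; exact: (subgroup_of_proj De).
have M_true x : S x -> box F e (M Q) (e true x).
  move=> Sx; split=> [|[]]; [exact: eS|by exists (e true x); first exact: eS|].
  by exists 1; [exact: subgroup1 sQ.1|rewrite (proj1 De) orth].
have M_false x : Q x -> box F e (M Q) (e false x).
  move=> Qx; have Sx := sQ.2 _ Qx.
  split=> [|[]]; [exact: eS| |by exists x => //; rewrite eet].
  by exists 1; rewrite ?(proj1 De) ?orth.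
have Phi_true x : S x -> Phi (e true x) = e true x.
  move=> Sx; apply: (proj_inj De) => [||b]; [|exact: eS|].
    by have /fshom_in/(_ (M_true _ Sx))[] := FPhi.
  rewrite PhiE; last exact: M_true.
  by case: b; rewrite ?orth// (fshom1 Fphi2).
have Phi_false x : Q x -> Phi (e false x) = e false (phi x).
  move=> Qx; have Sx := sQ.2 _ Qx; have Sfx := sR.2 _ (fshom_in Fphi Qx).
  apply: (proj_inj De) => [||b]; [|exact: eS|].
    by have /fshom_in/(_ (M_false _ Qx))[] := FPhi.
  rewrite PhiE; last exact: M_false.
  by case: b; rewrite ?orth// !eet// phi2E.
(* Psi has the images of Phi under both f's as components: it extends Phi, and
   it fixes f c (e true x) because it does so in each component. *)
have [sM sN] := fshom_obj FPhi.
have [psi psiP] := choice2 (fun b => proj_fun Df b FPhi).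
have fsub b P : P `<=` S -> f b @` P `<=` f b @` S.
  by move=> PS _ [x /PS Sx <-]; exists x.
have [b|b|b|Psi FPsi PsiE] := box_hom Df (P := fun b => f b @` box F e (M Q))
    (Q := fun b => f b @` box F e (M R)) (phi := psi).
- by apply: fsub; apply: sM.2.
- by apply: fsub; apply: sN.2.
- by have [] := psiP b.
set K := box F f _ in FPsi PsiE.
have MK x : box F e (M Q) x -> K x by move=> Mx; split=> [|b]; [exact: sM.2|exists x].
have KS x : K x -> S x by case.
have PsiM x : box F e (M Q) x -> Psi x = Phi x.
  move=> Mx; have Kx := MK _ Mx; apply: (proj_inj Df) => [||b].
  - by have /fshom_in/(_ Kx)[] := FPsi.
  - by have /fshom_in/(_ Mx)[] := FPhi.
  - by rewrite PsiE// (psiP b).2.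
have K_cross x : S x -> K (f c (e true x)).
  move=> Sx; have Sex := eS true x Sx; split=> [|b]; first exact: fS.
  have [->|bc] := eqVneq b c.
    by exists (e true x); [exact: M_true|rewrite (proj_idem Df)].
  exists 1; first by apply: subgroup1; exact: sM.1.
  by rewrite (proj1 Df) (proj_orth Df)//; apply/eqP.
have Psi_cross x : S x -> Psi (f c (e true x)) = f c (e true x).
  move=> Sx; have Sex := eS true x Sx; apply: (proj_inj Df) => [||b].
  - by have /fshom_in/(_ (K_cross _ Sx))[] := FPsi.
  - exact: fS.
  rewrite PsiE; last exact: K_cross.
  have [->|bc] := eqVneq b c.
    by rewrite !(proj_idem Df)// (psiP c).2 ?Phi_true//; exact: M_true.
  rewrite (proj_orth Df)//; last exact/eqP.
  by rewrite (fshom1 (psiP b).1).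
(* theta extends the second component of phi and fixes the image of g; it is
   put together with the first component of phi, for which the image of g is
   invisible. *)
have [theta Ftheta thetaE] := proj_fun De false FPsi.
have [_ sL] := fshom_obj FPsi; set L := box F f _ in FPsi Ftheta sL.
pose A b := if b then e b @` Q else e b @` K.
pose B b := if b then e b @` R else e b @` L.
have [b|b|b|h Fh hE] := box_hom De (P := A) (Q := B)
    (phi := fun b : bool => if b then phi1 else theta).
- by case: b; apply: esub; [exact: sQ.2|exact: KS].
- by case: b; apply: esub; [exact: sR.2|exact: sL.2].
- by case: b.
have QA : Q `<=` box F e A.
  move=> x Qx; have Sx := sQ.2 _ Qx; split=> // -[]; first by exists x.
  by exists (e false x); [apply: MK; exact: M_false|exact: eet].
have gA : g @` S `<=` box F e A.
  move=> _ [x Sx <-]; have Sfx := KS _ (K_cross x Sx).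
  split=> [|[]]; first exact: eS.
    by exists 1; [exact: subgroup1 sQ.1|rewrite (proj1 De) orth].
  by exists (f c (e true x)); [exact: K_cross|rewrite eet].
exists (box F e A), (box F e B), h; split=> // x; last first.
  case=> y Sy <-; have gAy : box F e A (g y) by apply: gA; exists y.
  have Sfy := KS _ (K_cross y Sy).
  apply: (proj_inj De) => [||b].
  - by have /fshom_in/(_ gAy)[] := Fh.
  - exact: eS.
  rewrite hE//; case: b; rewrite /g /=.
    by rewrite orth// (fshom1 Fphi1).
  by rewrite eet// thetaE ?Psi_cross//; exact: K_cross.
move=> Qx; have Sx := sQ.2 _ Qx; have Sfx := sR.2 _ (fshom_in Fphi Qx).
apply: (proj_inj De) => // [|b].
  by have /fshom_in/(_ (QA _ Qx))[] := Fh.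
rewrite hE; last exact: QA.
case: b; first exact: phi1E.
have Mx := M_false _ Qx; rewrite -[in LHS](eet false)// thetaE; last exact: MK.
by rewrite PsiM// Phi_false// eet.
Qed.

(** Extending conjugation by x in S shows that the image of [g] lies in the
    center of S.  This makes the products of subgroups in the definition of a
    central subgroup into subgroups, to which the extensions are restricted. *)
Lemma cross_central : central F (g @` S).
Proof.
have sS := fsgroupP F.
have /is_morphismP[hg _] := cross_mor.
have {}sg : subgroup_of S (g @` S) := fs_image hg (subgroup_of_fsgroup F).
have gcomm x z : S x -> (g @` S) z -> x * z = z * x.
  move=> Sx gz; have cx : F S S (lconj x).
    apply: fshom_conj; [exact: subgroup_of_fsgroup..|split; last by exists x].
    by move=> y Sy; do 2?[apply: subgroupM => //]; apply: subgroupV.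
  have [A [B [h [_ _ _ hS hg']]]] := cross_extension cx.
  have := hg' z gz; rewrite hS /lconj; last exact: sg.2.
  by move=> /(congr1 (fun y => y * x)); rewrite mulgVK.
split=> // Q R phi Fphi; have [sQ sR] := fshom_obj Fphi.
have [A [B [h [Fh QA gA hQ hg']]]] := cross_extension Fphi.
have sM P : subgroup_of S P -> subgroup_of S (setmulg P (g @` S)).
  move=> [sP PS]; split; last first.
    by move=> _ [x /PS Sx [z /sg.2 Sz <-]]; apply: subgroupM.
  apply/subgroupP; split.
    by exists 1; [exact: subgroup1|exists 1; [exact: subgroup1 sg.1|rewrite mulg1]].
  move=> _ _ [x Px [z gz <-]] [y Py [t gt <-]].
  have sgD := ((subgroupP _).1 sg.1).2; have sPD := ((subgroupP _).1 sP).2.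
  exists (x * y^-1); first exact: sPD.
  exists (z * t^-1); first exact: sgD.
  have gzt := sgD _ _ gz gt; have Sy := subgroupV sS (PS _ Py).
  by rewrite invgM -!mulgA [in RHS](mulgA z) -(gcomm _ _ Sy gzt) !mulgA.
have sA := (fshom_obj Fh).1.1.
have hM x : Q x -> forall z, (g @` S) z -> h (x * z) = phi x * z.
  by move=> Qx z gz; rewrite (homM (fshom_is_hom Fh) (QA _ Qx) (gA _ gz)) hQ ?hg'.
exists h; split; last 2 first.
- by move=> x /set_mem; apply: hQ.
- by move=> x /set_mem; apply: hg'.
apply: (fshom_restrict Fh) => //.
- by have [] := sM _ sQ.
- by move=> _ [x Qx [z gz <-]]; apply: subgroupM => //; [exact: QA|exact: gA].
- exact: sM.
move=> _ [x Qx [z gz <-]]; rewrite hM//; exists (phi x); first exact: fshom_in Fphi Qx.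
by exists z.
Qed.

End CrossTerms.

(** The common consequence of Z(F) = 1 and of foc(F) = S through which they
    enter the proof. *)
Definition no_central_endo (gT : groupType) (F : fusion_system gT) : Prop :=
  forall g, is_morphism F F g -> central F (g @` fsgroup F) ->
  forall x, fsgroup F x -> g x = 1.

Lemma no_central_endo_center (gT : groupType) (F : fusion_system gT) :
  fscenter F = [set 1] -> no_central_endo F.
Proof.
move=> Z1 g _ cg x Sx; suff: fscenter F (g x) by rewrite Z1.
by move=> T [_ ZT]; apply: ZT; exists (g @` fsgroup F) => //; exists x.
Qed.

(** If y is F-conjugate to x, then [g] induces a morphism of F that sends g x
    to g y; this morphism extends to one that fixes the central subgroup [g(S)],
    so g x = g y. *)
Lemma no_central_endo_focal (gT : groupType) (F : fusion_system gT) :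
  focal_subgroup F = fsgroup F -> no_central_endo F.
Proof.
move=> foc g /is_morphismP[hg mg] [_ cg] x Sx.
have sS := fsgroupP F.
pose K : set gT := [set y | fsgroup F y /\ g y = 1].
suff : K x by case.
have sK : subgroup K.
  apply/subgroupP; split; first by split; [exact: subgroup1|exact: hom1 hg].
  move=> y z [Sy gy] [Sz gz]; have Sz' := subgroupV sS Sz.
  split; first exact: subgroupM.
  by rewrite (homM hg)// (homV sS hg)// gy gz mulgV.
have: focal_subgroup F x by rewrite foc.
apply: generated_sub => //.
move=> _ [y [z [Sy Sz [phi Fphi phiy] ->]]]; have Sz' := subgroupV sS Sz.
split; first exact: subgroupM.
rewrite (homM hg)// (homV sS hg)//.
have [psi Fpsi psiE] := mg _ _ _ Fphi.
have gy : (generated [set y]) y by move=> T [_]; apply.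
have [h [_ hpsi hid]] := cg _ _ _ Fpsi.
have hgy : h (g y) = g y by rewrite hid ?inE//; exists y.
have := hpsi (g y); rewrite inE hgy psiE// phiy => <-; last by exists y.
exact: mulgV.
Qed.

(** * Indecomposable factors *)

Section Indecomposable.
Variable gT : groupType.
Implicit Types F E D : fusion_system gT.

Lemma ord2_bijective : bijective (fun i : 'I_2 => i == ord0).
Proof.
exists (fun b : bool => if b then ord0 else ord_max) => [i|[]//].
by case: eqP => [->//|/eqP]; case: i => -[|[|//]] //= ? _; apply: val_inj.
Qed.

Lemma binary_product F (f : bool -> gT -> gT) E D : decomposition F f ->
  full_subsystem E F -> full_subsystem D F -> fsgroup E = f true @` fsgroup F ->
  fsgroup D = f false @` fsgroup F -> is_product F (family2 E D).
Proof.
move=> Df fE fD ES DS.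
apply: (decomposition_product (decomposition_reindex ord2_bijective Df)) => i /=.
by rewrite /family2; case: ifP.
Qed.

(** [f false] is the projection onto a complement of [E], which is left
    unnamed because it is again determined by its underlying group. *)
Definition projects_onto F E (f : bool -> gT -> gT) : Prop :=
  [/\ decomposition F f, full_subsystem E F & fsgroup E = f true @` fsgroup F].

Lemma direct_factorP F E : direct_factor F E <-> exists f, projects_onto F E f.
Proof.
split=> [[D /product_decomposition[e De EP]]|[f [Df fE ES]]].
  have [t sK tK] := ord2_bijective.
  exists (e \o t); split; last 2 first.
  - by have [] := EP ord0.
  - by have tT : t true = ord0 := sK ord0; rewrite /= tT; have [] := EP ord0.
  by apply: decomposition_reindex De; exists (fun i : 'I_2 => i == ord0).
exists (restriction (subgroup_of_factor Df false)).
by apply: (binary_product Df) => //; apply: restriction_full.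
Qed.

Lemma indecomposableP E : indecomposable E <->
  forall f, decomposition E f ->
    (forall x, fsgroup E x -> f true x = x) \/ (forall x, fsgroup E x -> f true x = 1).
Proof.
split=> [indE f Df|H [E1 [E2 [[_ E1E] [_ E2E] /product_decomposition[e De EP]]]]].
  apply: contrapT => /not_orP[nid n1]; apply: indE.
  have sf b := subgroup_of_factor Df b.
  exists (restriction (sf true)), (restriction (sf false)).
  split=> /=; last by apply: (binary_product Df) => //; apply: restriction_full.
    split; first by case: (sf true).
    by move=> Ef; apply: nid => x /Ef; apply: (proj_fix Df).
  split; first by case: (sf false).
  by move=> Ef; apply: n1 => x /Ef; apply: (proj_kill Df).
have [t sK tK] := ord2_bijective; have tT : t true = ord0 := sK ord0.
have /H[] : decomposition E (e \o t).
- by apply: decomposition_reindex De; exists (fun i : 'I_2 => i == ord0).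
- move=> fid; apply: E1E => x Ex; have [_ /= ->] := EP ord0.
  by exists x => //; have := fid x Ex; rewrite /= tT.
- move=> f1; apply: E2E => x Ex; have [_ /= ->] := EP ord_max.
  exists x => //; apply: (proj_inj De) => // [|i]; first exact: projS De _ _ Ex.
  have [->|/eqP i_max] := eqVneq i ord_max; first by rewrite (proj_idem De).
  rewrite (proj_orth De)//; have -> : i = ord0.
    by case: i i_max => -[|[|//]] //= ? H1; [exact: val_inj|case: H1; exact: val_inj].
  by have := f1 x Ex; rewrite /= tT.
Qed.

Variable F : fusion_system gT.
Hypothesis rigF : no_central_endo F.
Local Notation S := (fsgroup F).

(** Both sides are equal to [e b (f c (e b x))], since the cross terms
    vanish. *)
Lemma projections_commute (e f : bool -> gT -> gT) b c x :
  decomposition F e -> decomposition F f -> S x -> e b (f c x) = f c (e b x).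
Proof.
move=> De Df.
have cross d y : S y -> e (~~ d) (f c (e d y)) = 1.
  case: d => Sy; first exact: (rigF (cross_mor De Df c) (cross_central De Df c)).
  have De' : decomposition F (e \o negb).
    by apply: decomposition_reindex De; exists negb; exact: negbK.
  exact: (rigF (cross_mor De' Df c) (cross_central De' Df c)).
have eS := projS De; have fS := projS Df.
move=> Sx; rewrite [in LHS](binary_join De b Sx).
have Sb := eS b x Sx; have Sb' := eS (~~ b) x Sx.
rewrite (projM Df)// (projM De); [|exact: fS..].
have := cross (~~ b) x Sx; rewrite negbK => ->; rewrite mulg1.
by rewrite [RHS](binary_join De b) ?cross ?mulg1//; exact: fS.
Qed.

Lemma indecomposable_dichotomy E e (f : bool -> gT -> gT) :
  projects_onto F E e -> indecomposable E -> decomposition F f ->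
  (forall x, fsgroup E x -> f true x = x) \/ (forall x, fsgroup E x -> f true x = 1).
Proof.
move=> [De fE ES] /indecomposableP indE Df; apply: indE.
apply: (decomposition_restrict Df fE) => b _ /[!ES] -[x Sx <-].
by rewrite -(projections_commute true b De Df Sx); exists (f b x) => //; exact: projS.
Qed.

(** Since [f true] is not trivial on E it is the identity there, so E is
    contained in D; but then [e true] is not trivial on D and the argument
    applies in the other direction. *)
Lemma indecomposable_factor_eq E D e f x : projects_onto F E e ->
  projects_onto F D f -> indecomposable E -> indecomposable D ->
  fsgroup E x -> f true x <> 1 -> E = D.
Proof.
move=> pE pD indE indD Ex fx1; have [De fE ES] := pE; have [Df fD DS] := pD.
have ES' := fE.1.1; have DS' := fD.1.1.
have [f_id|/(_ _ Ex)//] := indecomposable_dichotomy pE indE Df.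
have Dx : fsgroup D x by rewrite DS; exists x; [exact: ES'|exact: f_id].
have [e_id|/(_ _ Dx) ex1] := indecomposable_dichotomy pD indD De; last first.
  by case: fx1; rewrite f_id// -ex1; rewrite (proj_fix De)// -ES.
apply: full_subsystem_eq fE fD _; apply/seteqP; split=> y.
  by move=> Ey; rewrite DS; exists y; [exact: ES'|exact: f_id].
by move=> Dy; rewrite ES; exists y; [exact: DS'|exact: e_id].
Qed.

End Indecomposable.

(** * Uniqueness *)

Section Factorizations.
Variables (gT : groupType) (F : fusion_system gT).
Hypothesis rigF : no_central_endo F.
Local Notation S := (fsgroup F).
Implicit Types D : fusion_system gT.

(** The other factors together form a complement of [E i]. *)
Lemma product_projects_onto k (E : 'I_k -> fusion_system gT) :
  is_product F E -> exists2 e, decomposition F e & forall i,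
    exists2 d, projects_onto F (E i) d & forall x, S x -> d true x = e i x.
Proof.
move=> /product_decomposition[e De EP]; exists e => // i.
have [d Dd dE] := decomposition_coarsen (fun j => j == i) De.
have deE x : S x -> d true x = e i x.
  move=> Sx; apply: (proj_inj De) => [||j]; [exact: projS|exact: projS|].
  rewrite dE// eqb_id; case: eqP => [->|ji]; first by rewrite (proj_idem De).
  by rewrite (proj_orth De).
exists d => //; split=> //; first by have [] := EP i.
by have [_ ->] := EP i; apply/esym; apply: eq_imagel.
Qed.

Lemma set1_nontrivial (P : set gT) : P 1 -> P <> [set 1] -> exists2 x, P x & x <> 1.
Proof.
move=> P1 nP; apply: contrapT => H; apply: nP; apply/seteqP; split=> [x Px|_ ->//].
by apply: contrapT => x1; apply: H; exists x.
Qed.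

Lemma product_nontrivial_inj k (E : 'I_k -> fusion_system gT) i j :
  is_product F E -> E i = E j -> fsgroup (E i) <> [set 1] -> i = j.
Proof.
move=> /product_decomposition[e De EP] Eij nE; apply: contrapT => ij.
have [x Ex x1] := set1_nontrivial (subgroup1 (fsgroupP _)) nE.
apply: x1; have := Ex; rewrite {1}Eij (EP j).2 => /(proj_kill De ij) <-.
by rewrite (proj_fix De)// -(EP i).2.
Qed.

Lemma indecomposable_factor_in k (E : 'I_k -> fusion_system gT) D :
  is_product F E -> (forall i, indecomposable (E i)) -> direct_factor F D ->
  indecomposable D -> fsgroup D <> [set 1] -> exists i, D = E i.
Proof.
move=> /product_projects_onto[e De EP] indE /direct_factorP[f pD] indD nD.
have [x Dx x1] := set1_nontrivial (subgroup1 (fsgroupP _)) nD.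
have Sx : S x by case: pD => _ [[DS _] _] _; apply: DS.
have [i ex1] : exists i, e i x <> 1.
  apply: contrapT => H; apply: x1; apply: (proj_inj De) => // [|i].
    exact: subgroup1 (fsgroupP F).
  by rewrite (proj1 De); apply: contrapT => H'; apply: H; exists i.
have [d pE dE] := EP i; exists i.
by apply: (indecomposable_factor_eq rigF pD pE indD (indE i) Dx); rewrite dE.
Qed.

Lemma product_direct_factor k (E : 'I_k -> fusion_system gT) i :
  is_product F E -> direct_factor F (E i).
Proof.
move=> /product_projects_onto[e _ EP]; have [d pE _] := EP i.
by apply/direct_factorP; exists d.
Qed.

(** With a single factor this is not part of the definition, but then the
    factor is all of S. *)
Lemma factor_nontrivial k (E : 'I_k -> fusion_system gT) i :
  indecomposable_factorization F E -> S <> [set 1] -> fsgroup (E i) <> [set 1].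
Proof.
case=> k0 /product_decomposition[e De EP] _ ntE nS.
have [k2|k1] := leqP 2 k; first exact: ntE.
have {k0 k1}k1 : k = 1%N by apply/eqP; rewrite eqn_leq k0 -ltnS k1.
subst k; have [x Sx x1] := set1_nontrivial (subgroup1 (fsgroupP F)) nS.
move=> E1; apply: x1; apply: (proj_inj De) => // [|j].
  exact: subgroup1 (fsgroupP F).
rewrite (proj1 De) (ord1 j) -(ord1 i).
have : fsgroup (E i) (e i x) by rewrite (EP i).2; exists x.
by rewrite E1.
Qed.

Lemma factor_trivial D : full_subsystem D F -> S = [set 1] -> fsgroup D = [set 1].
Proof.
move=> [[DS _] _] S1; apply/seteqP; split=> [x /DS|_ ->]; first by rewrite S1.
exact: subgroup1 (fsgroupP D).
Qed.

Lemma factorization_trivial k (E : 'I_k -> fusion_system gT) :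
  indecomposable_factorization F E -> S = [set 1] -> k = 1%N.
Proof.
case=> k0 /product_decomposition[e De EP] _ ntE S1.
apply/eqP; rewrite eqn_leq k0 andbT leqNgt; apply/negP => k2.
apply: (ntE k2 (Ordinal k0)); apply: factor_trivial => //.
by have [] := EP (Ordinal k0).
Qed.

(** Every nontrivial [E i] is some [D j] and conversely; these assignments are
    inverse to each other because nontrivial factors of a product are pairwise
    different.  The trivial group S is treated apart. *)
Lemma factorization_unique k l (E : 'I_k -> fusion_system gT)
    (D : 'I_l -> fusion_system gT) :
  indecomposable_factorization F E -> indecomposable_factorization F D ->
  exists2 s : 'I_k -> 'I_l, bijective s & forall i, E i = D (s i).
Proof.
move=> fE fD; have [_ pE indE _] := fE; have [_ pD indD _] := fD.
have [S1|nS] := pselect (S = [set 1]).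
  have k1 := factorization_trivial fE S1; have l1 := factorization_trivial fD S1.
  subst k l; exists id => [|i]; first by exists id.
  have [e _ EP] := product_decomposition pE; have [d _ DP] := product_decomposition pD.
  have [fEi _] := EP i; have [fDi _] := DP i.
  apply: (full_subsystem_eq fEi fDi); rewrite (factor_trivial fEi S1).
  by rewrite (factor_trivial fDi S1).
have ntE i := factor_nontrivial (i := i) fE nS.
have ntD i := factor_nontrivial (i := i) fD nS.
have [s sE] := choice (fun i => indecomposable_factor_in pD indD
  (product_direct_factor i pE) (indE i) (ntE i)).
have [t tD] := choice (fun i => indecomposable_factor_in pE indE
  (product_direct_factor i pD) (indD i) (ntD i)).
exists s => //; exists t => i.
  by apply: product_nontrivial_inj pE _ _; rewrite -tD -sE//.
by apply: product_nontrivial_inj pD _ _; rewrite -sE -tD//.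
Qed.

End Factorizations.

(** * Torsion in discrete p-toral groups *)

Local Open Scope card_scope.

Lemma inj_leq_card (T : Type) (A : set T) (f : nat -> T) m n :
  (forall k, (k < m)%N -> A (f k)) -> {in `I_m &, injective f} ->
  A #= `I_n -> (m <= n)%N.
Proof.
move=> fA finj An; rewrite -card_le_II -(card_le_eqr An).
rewrite -(card_le_eql (inj_card_eq finj)).
by apply: subset_card_le => _ [k /= km <-]; apply: fA.
Qed.

Lemma card_leq_range (T : Type) (A : set T) (f : nat -> T) m n :
  (forall y, A y -> exists2 k, (k < m)%N & y = f k) -> A #= `I_n -> (n <= m)%N.
Proof.
move=> Af An; rewrite -card_le_II -(card_le_eql An).
apply: card_le_trans (card_image_le f `I_m).
by apply: subset_card_le => y /Af[k km ->]; exists k.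
Qed.

Lemma cyclic_of_orderP (gT : groupType) (m : nat) (C : set gT) :
  cyclic_of_order m C -> exists x, [/\ C x,
    forall y, C y -> exists k, y = x ^+ k, x ^+ m = 1
    & forall a, x ^+ a = 1 -> (m %| a)%N].
Proof.
move=> [x [CE Cm]]; have sC : subgroup C by rewrite CE; exact: subgroup_generated.
have Cx : C x by rewrite CE => T [_]; apply.
have CX k : C (x ^+ k) by exact: subgroupX.
have expg_eq i j : (i <= j)%N -> x ^+ i = x ^+ j -> x ^+ (j - i) = 1.
  by move=> ij xij; apply: (mulgI (x ^+ i)); rewrite -expgnDr subnKC// mulg1.
have d_ex : exists d, (0 < d)%N && (x ^+ d == 1).
  apply: contrapT => nd; suff : (m.+1 <= m)%N by rewrite ltnn.
  apply: (@inj_leq_card _ C (fun k => x ^+ k)) => // i j _ _ /= xij.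
  apply: contrapT => /eqP; rewrite neq_ltn => /orP[] ij; apply: nd.
    by exists (j - i)%N; rewrite subn_gt0 ij/= expg_eq// ltnW.
  by exists (i - j)%N; rewrite subn_gt0 ij/= expg_eq// ltnW.
have [d /andP[d0 /eqP xd] dmin] := ex_minnP d_ex.
have modE k : x ^+ k = x ^+ (k %% d).
  by rewrite {1}(divn_eq k d) expgnDr mulnC expgnA xd expg1n mul1g.
have d_dvd a : x ^+ a = 1 -> (d %| a)%N.
  rewrite modE /dvdn => xa; rewrite -leqn0 leqNgt; apply/negP => a0.
  have := dmin (a %% d)%N; rewrite a0 xa eqxx => /(_ isT).
  by rewrite leqNgt ltn_mod d0.
have CE' y : C y -> exists2 k, (k < d)%N & y = x ^+ k.
  rewrite CE; pose D := [set y | exists2 k, (k < d)%N & y = x ^+ k].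
  have DX k : D (x ^+ k) by exists (k %% d)%N; rewrite ?ltn_mod//; exact: modE.
  apply: (@generated_sub _ [set x] D) => [|_ ->]; last exact: (DX 1%N).
  apply/subgroupP; split; first exact: (DX 0%N).
  move=> _ _ [k kd ->] [l ld ->]; have -> : (x ^+ l)^-1 = x ^+ (d - l).
    by apply: mulg1_eq; rewrite -expgnDr subnKC// ltnW.
  by rewrite -expgnDr; apply: DX.
have -> : m = d.
  apply/eqP; rewrite eqn_leq (card_leq_range CE' Cm)/=.
  apply: (@inj_leq_card _ C (fun k => x ^+ k)) => // i j.
  rewrite !inE /= => id jd xij; wlog ij : i j id jd xij / (i <= j)%N.
    by move=> H; case/orP: (leq_total i j) => ij; [exact: H|apply/esym; exact: H].
  have := d_dvd _ (expg_eq _ _ ij xij); rewrite /dvdn modn_small.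
    by rewrite subn_eq0 => ji; apply/eqP; rewrite eqn_leq ij.
  exact: leq_ltn_trans (leq_subr _ _) jd.
by exists x; split=> // y /CE'[k _ ->]; exists k.
Qed.

Section Quasicyclic.
Variables (p : nat) (gT : groupType) (C : set gT).
Hypotheses (pr_p : prime p) (qC : quasicyclic p C).

Lemma quasicyclic_torsion x : C x -> exists a, x ^+ (p ^ a)%N = 1.
Proof.
case: qC => c [cyc _ ->] [n _ cx].
have [g [_ gE g1 _]] := cyclic_of_orderP (cyc n); have [k ->] := gE x cx.
by exists n.+1; rewrite expgnAC g1 expg1n.
Qed.

(** All of these elements lie in the bottom group [c 0], which is finite: in a
    cyclic group of order p^(n+1) with generator g they are powers of
    w = g^(p^n), and w is a power of the generator h of [c 0] because h is a
    power of w with exponent prime to p. *)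
Lemma quasicyclic_omega : finite_set [set x | C x /\ x ^+ p = 1].
Proof.
case: qC => c [cyc inc ->]; have p0 := prime_gt0 pr_p.
have c0n n : c 0%N `<=` c n by elim: n => // n IHn x /IHn/inc.
apply: (@sub_finite_set _ _ (c 0%N)); last first.
  by apply/finite_setP; exists (p ^ 1)%N; have [x []] := cyc 0%N.
move=> x [[n _ cx] xp].
have [g [cg gE g1 g_dvd]] := cyclic_of_orderP (cyc n).
have [h [ch _ h1 h_dvd]] := cyclic_of_orderP (cyc 0%N).
rewrite expn1 in h1 h_dvd; pose w := g ^+ (p ^ n)%N.
have wp : w ^+ p = 1 by rewrite /w -expgnA -expnSr.
have powE y : c n y -> y ^+ p = 1 -> exists b, y = w ^+ b.
  move=> /gE[k ->]; rewrite -expgnA => /g_dvd; rewrite expnSr dvdn_pmul2r//.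
  by case/dvdnP=> b ->; exists b; rewrite mulnC expgnA.
have [b ->] := powE _ cx xp; have [b0 hE] := powE _ (c0n n _ ch) h1.
have cop : coprime p b0.
  rewrite prime_coprime//; apply/negP => /dvdnP[q b0E].
  have h11 : h ^+ 1 = 1 by rewrite expg1 hE b0E mulnC expgnA wp expg1n.
  by have := h_dvd _ h11; rewrite dvdn1 => /eqP p1; have := pr_p; rewrite p1.
have b00 : (0 < b0)%N.
  case: b0 cop {hE} => //; rewrite /coprime gcdn0 => /eqP p1.
  by have := pr_p; rewrite p1.
have sc : subgroup (c 0%N) by have [y [-> _]] := cyc 0%N; exact: subgroup_generated.
apply: subgroupX => //; case: (egcdnP p b00) => km kn kE _.
have gcd1 : gcdn b0 p = 1%N by apply/eqP; rewrite -/(coprime _ _) coprime_sym.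
suff -> : w = h ^+ km by apply: subgroupX.
rewrite hE -expgnA mulnC kE gcd1 expgnDr expg1 mulnC expgnA wp expg1n.
by rewrite mul1g.
Qed.

End Quasicyclic.

Lemma expg_ffun (I : finType) (gT : groupType) (x : {ffun I -> gT}) n i :
  (x ^+ n) i = x i ^+ n.
Proof. by elim: n => [|n IHn]; rewrite ?expg0 ?ffunE// !expgS ffunE IHn. Qed.

Lemma finite_ffun (I : finType) (gT : groupType) (O : set gT) :
  finite_set O -> finite_set [set x : {ffun I -> gT} | forall i, O (x i)].
Proof.
move=> /finite_seqP[s ->].
pose h (u : {ffun I -> 'I_(size s).+1}) : {ffun I -> gT} := [ffun i => nth 1 s (u i)].
apply: (@sub_finite_set _ _ (h @` setT)); last exact/finite_image/finite_finset.
move=> x xs; exists [ffun i => inord (index (x i) s)] => //.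
apply/ffunP => i; rewrite !ffunE inordK ?nth_index//; first exact: xs.
exact: index_size.
Qed.

Lemma subgroup_quasicyclic (p : nat) (gT : groupType) (C : set gT) :
  quasicyclic p C -> subgroup C.
Proof.
move=> [c [cyc inc ->]]; have sc k : subgroup (c k).
  by have [y [-> _]] := cyc k; exact: subgroup_generated.
have cle i j : (i <= j)%N -> c i `<=` c j.
  move=> /subnK <-; elim: (j - i)%N => // k IHk y /IHk.
  by rewrite addSn; apply: inc.
apply/subgroupP; split; first by exists 0%N => //; exact: subgroup1.
move=> y z [i _ cy] [j _ cz]; exists (maxn i j) => //.
apply: subgroupM => //; first exact: (cle _ _ (leq_maxl i j) _ cy).
by apply: subgroupV => //; exact: (cle _ _ (leq_maxr i j) _ cz).
Qed.

Lemma subgroup_ffun (I : finType) (gT : groupType) (C : set gT) :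
  subgroup C -> subgroup [set x : {ffun I -> gT} | forall i, C (x i)].
Proof.
move=> sC; apply/subgroupP; split=> [i|y z Cy Cz i]; rewrite !ffunE.
  exact: subgroup1.
by apply: subgroupM => //; apply: subgroupV.
Qed.

Section Torus.
Variables (p : nat) (gT : groupType) (T : set gT).
Hypotheses (pr_p : prime p) (tT : discrete_torus p T).

Lemma torus_torsion x : T x -> exists a, x ^+ (p ^ a)%N = 1.
Proof.
case: tT => n [hT [C [f [qC [hf [_ _ surjf]]]]]] /surjf[u Cu <-].
have [a aP] := choice (fun i => quasicyclic_torsion qC (Cu i)).
have sU := subgroup_ffun 'I_n (subgroup_quasicyclic qC).
exists (\max_i a i)%N; rewrite -(homX _ sU hf)//.
suff -> : u ^+ (p ^ \max_i a i)%N = 1 by exact: hom1 hf.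
apply/ffunP => i; rewrite expg_ffun ffunE.
by rewrite -(subnKC (leq_bigmax i)) expnD expgnA aP expg1n.
Qed.

Lemma torus_omega : finite_set [set x | T x /\ x ^+ p = 1].
Proof.
case: tT => n [hT [C [f [qC [hf [_ injf surjf]]]]]].
have := finite_image f (finite_ffun 'I_n (quasicyclic_omega pr_p qC)).
apply: sub_finite_set => x [/surjf[u Cu <-] fup]; exists u => // i; split=> //.
have sU := subgroup_ffun 'I_n (subgroup_quasicyclic qC).
have up : u ^+ p = 1.
  apply: injf; rewrite ?inE; [exact: (subgroupX _ sU)|exact: (subgroup1 sU)|].
  by rewrite (homX _ sU hf)// fup (hom1 sU hf).
by rewrite -expg_ffun up ffunE.
Qed.

Lemma torus_order_p x : T x -> x <> 1 -> exists b,
  x ^+ b <> 1 /\ (x ^+ b) ^+ p = 1.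
Proof.
move=> Tx x1; have : exists a, x ^+ (p ^ a)%N == 1.
  by have [a xa] := torus_torsion Tx; exists a; apply/eqP.
case/ex_minnP=> -[|a] /eqP xa amin; first by case: x1; rewrite -[x]expg1.
exists (p ^ a)%N; split; last by rewrite -expgnA -expnSr.
by move=> /eqP /amin; rewrite ltnn.
Qed.

End Torus.

Lemma coset_number (gT : groupType) (S T : set gT) m : subgroup T ->
  lcosets T S #= `I_m -> exists r : gT -> nat,
    (forall x, S x -> (r x < m)%N) /\
    forall x y, S x -> S y -> r x = r y -> T (x^-1 * y).
Proof.
move=> sT /card_set_bijP[f [fm finj _]].
exists (fun x => f [set x * y | y in T]); split=> [x Sx|x y Sx Sy rxy].
  by apply: fm; exists x.
have xTyT : [set x * z | z in T] = [set y * z | z in T].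
  by apply: finj; rewrite ?inE//; [exists x|exists y].
have : [set x * z | z in T] y.
  by rewrite xTyT; exists 1; [exact: subgroup1|exact: mulg1].
by case=> z Tz <-; rewrite mulKg.
Qed.

(** * The number of factors *)

Section FactorBound.
Variables (gT : groupType) (F : fusion_system gT) (n : nat).
Variable e : 'I_n -> gT -> gT.
Hypothesis De : decomposition F e.
Hypothesis nte : forall i, exists2 x, fsgroup F x & e i x <> 1.
Local Notation S := (fsgroup F).

(** Two of the m + 1 partial products of nontrivial elements of the m factors
    with index a <= i < a + m lie in the same coset of T.  Their quotient is a
    nontrivial element of T, and [u] is a power of it. *)
Lemma block_torsion p m T a : (a + m <= n)%N -> discrete_torus p T ->
  subgroup T -> T `<=` S -> lcosets T S #= `I_m ->
  exists u, [/\ T u, u ^+ p = 1, u <> 1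
    & forall i : 'I_n, ~~ (a <= i < a + m)%N -> e i u = 1].
Proof.
move=> amn tT sT TS Tm; have sS := fsgroupP F.
have [r [rm rT]] := coset_number sT Tm.
have zex i : exists z, (e i @` S) z /\ z <> 1.
  by have [x Sx ex] := nte i; exists (e i x); split=> //; exists x.
have [z zP] := choice zex.
(* s k is the product of the z i with i < k. *)
have sex k : exists s, S s /\ forall i : 'I_n, e i s = if (i < k)%N then z i else 1.
  have [i|s Ss sE] := joint_value De
    (t := fun i : 'I_n => if (i < k)%N then z i else 1).
    case: ifP => _; first by have [] := zP i.
    by exists 1; rewrite ?(proj1 De)//; exact: subgroup1.
  by exists s.
have [s sP] := choice sex; have Ss k := (sP k).1; have sE k := (sP k).2.
(* There are m + 1 values of j in [0, m] and only m cosets of T. *)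
have [j [j' [jj' j'm rjj']]] : exists j j',
    [/\ (j < j')%N, (j' <= m)%N & r (s (a + j)%N) = r (s (a + j')%N)].
  apply: contrapT => nj; suff : (m.+1 <= m)%N by rewrite ltnn.
  apply: (@pigeonhole _ _ (fun j => r (s (a + j)%N))); last first.
    by move=> _ [j _ <-]; exact: rm.
  move=> j j'; rewrite !inE /= !ltnS => jm j'm rjj'.
  apply: contrapT => /eqP; rewrite neq_ltn => /orP[] jj'; apply: nj.
    by exists j, j'.
  by exists j', j.
set v := (s (a + j)%N)^-1 * s (a + j')%N.
have Tv : T v by apply: rT.
have Sv : S v by exact: TS.
have vE i : e i v = (if (i < a + j)%N then z i else 1)^-1 *
                    (if (i < a + j')%N then z i else 1).
  by rewrite (projM De)// ?(homV sS (proj_hom De i))// ?sE//; exact: subgroupV.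
have v1 : v <> 1.
  have ajn : (a + j < n)%N.
    by apply: leq_trans amn; rewrite ltn_add2l; apply: leq_trans jj' _.
  move=> v1; have := vE (Ordinal ajn); rewrite v1 (proj1 De) /= ltnn ltn_add2l jj'.
  by rewrite invg1 mul1g => /esym; apply: (zP (Ordinal ajn)).2.
have [b [vb1 vbp]] := torus_order_p tT Tv v1.
exists (v ^+ b); split=> // [|i iam]; first exact: subgroupX.
rewrite (homX _ sS (proj_hom De i))// vE.
move: iam; rewrite negb_and -ltnNge -leqNgt => /orP[ia|mi].
  by rewrite !(leq_trans ia (leq_addr _ _)) mulVg expg1n.
have aji k : (k <= m)%N -> (i < a + k)%N = false.
  by move=> km; apply/negbTE; rewrite -leqNgt; apply: leq_trans mi; rewrite leq_add2l.
by rewrite !aji// ?invg1 ?mul1g ?expg1n//; apply: leq_trans (ltnW jj') j'm.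
Qed.

(** The w + 1 blocks of m consecutive factors would give w + 1 elements of T
    killed by p, and these are different because a nontrivial element has a
    nontrivial component in its own block. *)
Lemma factor_count_lt p T m w : discrete_torus p T ->
  subgroup T -> T `<=` S -> lcosets T S #= `I_m ->
  [set x | T x /\ x ^+ p = 1] #= `I_w -> (n < w.+1 * m)%N.
Proof.
move=> tT sT TS Tm Ow; rewrite ltnNge; apply/negP => wmn.
have uex t : exists u, (t < w.+1)%N -> [/\ T u, u ^+ p = 1, u <> 1
    & forall i : 'I_n, ~~ (t * m <= i < t * m + m)%N -> e i u = 1].
  have [tw|tw] := ltnP t w.+1; last by exists 1.
  have [|u uP] := @block_torsion p m T (t * m)%N _ tT sT TS Tm.
    by rewrite addnC -mulSn; apply: leq_trans wmn; rewrite leq_mul2r tw orbT.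
  by exists u.
have [u uP] := choice uex; suff : (w.+1 <= w)%N by rewrite ltnn.
apply: (inj_leq_card _ _ Ow (f := u)) => [t /uP[]//|t t'].
rewrite !inE /= => tw t'w ut; apply: contrapT => tt'.
have [Tu _ u1 eu] := uP _ tw; have [_ _ _ eu'] := uP _ t'w.
apply: u1; apply: (proj_inj De) => [||i]; [exact: TS|exact: subgroup1 (fsgroupP F)|].
rewrite (proj1 De); have [it|/eu//] := boolP (t * m <= i < t * m + m)%N.
rewrite ut; apply: eu'; apply/negP => it'; apply: tt'.
have divE k : (k * m <= i < k * m + m)%N -> (i %/ m)%N = k.
  move=> /andP[ki ik]; have m0 : (0 < m)%N.
    by rewrite -(ltn_add2l (k * m)%N) addn0; apply: leq_ltn_trans ik.
  by apply/eqP; rewrite eqn_leq -ltnS ltn_divLR// mulSn addnC ik leq_divRL.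
by rewrite -(divE _ it) (divE _ it').
Qed.

End FactorBound.

Lemma factor_count_bounded p (gT : groupType) (F : fusion_system gT) :
  prime p -> discrete_p_toral p (fsgroup F) -> exists N, forall n e,
    @decomposition gT F 'I_n e ->
    (forall i, exists2 x, fsgroup F x & e i x <> 1) -> (n <= N)%N.
Proof.
move=> pr_p [_ [T [[sT TS] _ tT [m Tm]]]].
have /finite_setP[w Ow] := torus_omega pr_p tT.
exists (w.+1 * p ^ m)%N => n e De nte.
exact/ltnW/(factor_count_lt De nte tT sT TS Tm Ow).
Qed.

(** * Existence *)

Section Existence.
Variables (gT : groupType) (F : fusion_system gT).
Local Notation S := (fsgroup F).

Definition nontrivial_factors n (e : 'I_n -> gT -> gT) : Prop :=
  forall i, exists2 x, S x & e i x <> 1.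

Section Split.
Variables (n : nat) (e : 'I_n -> gT -> gT).
Hypotheses (De : decomposition F e) (nte : nontrivial_factors e).
Let E i := restriction (subgroup_of_factor De i).

(** Refining a decomposition along [halves (i == i0)] splits the factor with
    index [i0] and keeps the others. *)
Definition halves (b : bool) : finType :=
  if b then (bool : finType) else (unit : finType).

Definition half_proj (f : bool -> gT -> gT) b : halves b -> gT -> gT :=
  match b with true => f | false => fun=> id end.

Lemma split_factor i0 f : decomposition (E i0) f ->
  (exists2 x, fsgroup (E i0) x & f true x <> x) ->
  (exists2 x, fsgroup (E i0) x & f true x <> 1) ->
  exists m (d : 'I_m -> gT -> gT),
    [/\ (n < m)%N, decomposition F d & nontrivial_factors d].
Proof.
move=> Df [x Ex fx] [y Ey fy].
pose J (i : 'I_n) := halves (i == i0).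
pose a (i : 'I_n) : J i -> gT -> gT := @half_proj f (i == i0).
have Da i : decomposition (E i) (@a i).
  rewrite /a /J; case: (eqVneq i i0) => [->|_] //=.
  by apply: (decomposition_id _ (i0 := tt)) => -[].
have EP i : full_subsystem (E i) F /\ fsgroup (E i) = e i @` S.
  by split=> //; exact: restriction_full.
have Dd := decomposition_refine De EP Da.
have nta (k : {i & J i}) : exists2 z, S z & a (tag k) (tagged k) (e (tag k) z) <> 1.
  case: k => i; rewrite /a /J /=; case: (eqVneq i i0) => [->|_] j; last exact: nte.
  have ES : fsgroup (E i0) `<=` S by exact: factor_sub.
  have efix z : fsgroup (E i0) z -> e i0 z = z by exact: proj_fix.
  case: j => /=; first by exists y; [exact: ES|rewrite efix].
  exists x; [exact: ES|rewrite efix// => f1; apply: fx].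
  by rewrite [RHS](binary_join Df true Ex) f1 mulg1.
exists #|{: {i & J i}}|, (fun k => a (tag (enum_val k)) (tagged (enum_val k)) \o
  e (tag (enum_val k))); split; last 2 first.
- exact: (decomposition_reindex (@enum_val_bij _) Dd).
- by move=> k; apply: nta.
pose h b : halves b := match b with true => true | false => tt end.
pose h' b : halves b := match b with true => false | false => tt end.
pose g (o : option 'I_n) : {i & J i} :=
  if o is Some i then Tagged J (h (i == i0)) else Tagged J (h' (i0 == i0)).
rewrite -[n in (n < _)%N]card_ord -card_option; apply: (@leq_card _ _ g).
have hh' (b : bool) : b -> h b <> h' b by case: b.
have ghh' i : g (Some i) <> g None.
  move=> gE; have ii : i = i0 := congr1 tag gE; subst i.
  by apply: (hh' (i0 == i0)) => //; exact: eq_from_Tagged gE.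
move=> [i|] [i'|] //; first by move=> /(congr1 tag)/= ->.
  by move/ghh'.
by move/esym/ghh'.
Qed.

End Split.

(** The factors of a decomposition with the largest number of nontrivial
    factors cannot be split any more. *)
Lemma factorization_exists p : prime p -> discrete_p_toral p S ->
  exists k (E : 'I_k -> fusion_system gT), indecomposable_factorization F E.
Proof.
move=> pr_p tS.
have D1 : decomposition F (fun _ : 'I_1 => id) by apply: decomposition_id; exact: ord1.
have [S1|nS] := pselect (S = [set 1]).
  exists 1%N, (fun=> F); split=> //.
    apply: (decomposition_product D1) => _; rewrite image_id; split=> //.
    exact: full_subsystem_refl.
  move=> _ [E1 [E2 [[_ E1F] _ _]]]; apply: E1F; rewrite S1 => _ ->.
  exact: subgroup1 (fsgroupP E1).
have [N Nbound] := factor_count_bounded pr_p tS.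
pose P n := `[< exists e : 'I_n -> gT -> gT,
  decomposition F e /\ nontrivial_factors e >].
have [x Sx x1] := set1_nontrivial (subgroup1 (fsgroupP F)) nS.
have P1 : P 1%N by apply/asboolP; exists (fun=> id); split=> // i; exists x.
have PN n : P n -> (n <= N)%N by move=> /asboolP[e [De /(Nbound _ _ De)]].
case: (ex_maxnP (ex_intro _ 1%N P1) PN) => n /asboolP[e [De nte]] nmax.
pose E i := restriction (subgroup_of_factor De i).
have EP i : full_subsystem (E i) F /\ fsgroup (E i) = e i @` S.
  by split=> //; exact: restriction_full.
exists n, E; split; [exact: nmax P1|exact: (decomposition_product De)| |].
  move=> i; apply/indecomposableP => f Df; apply: contrapT => /not_orP[nid n1].
  have [||m [d [nm Dd ntd]]] := split_factor nte Df.
  - apply: contrapT => H; apply: nid => y Ey; apply: contrapT => fy.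
    by apply: H; exists y.
  - apply: contrapT => H; apply: n1 => y Ey; apply: contrapT => fy.
    by apply: H; exists y.
  have /nmax : P m by apply/asboolP; exists d.
  by rewrite leqNgt nm.
move=> _ i E1; have [y Sy] := nte i; apply.
have : fsgroup (E i) (e i y) by exists y.
by rewrite E1.
Qed.

End Existence.

(** * The set of indecomposable direct factors *)

Section AllFactors.
Variables (gT : groupType) (F : fusion_system gT).
Local Notation S := (fsgroup F).

Definition trivial_fs : fusion_system gT := restriction (subgroup_of_trivial F).

Lemma decomposition_option (I : Type) (e : I -> gT -> gT) : decomposition F e ->
  decomposition F (fun o : option I => if o is Some i then e i else fun=> 1).
Proof.
move=> De; have sS := fsgroupP F; have S1 := subgroup1 sS.
split.
- case=> [i|]; first exact: (proj_mor De).
  apply/is_morphismP; split; first by apply: is_homI => // *; rewrite mulg1.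
  move=> P Q f Ff; have [[sP _] [sQ _]] := fshom_obj Ff.
  exists id => //.
  have im1 (P' : set gT) : subgroup P' -> (fun=> 1) @` P' = [set 1 : gT].
    move=> sP'; apply/seteqP; split=> [_ [x _ <-]//|_ ->].
    by exists 1 => //; exact: subgroup1.
  by rewrite !im1//; apply: fshom_incl => //; exact: subgroup_of_trivial.
- by case=> // i x; apply: (proj_idem De).
- case=> [i|] [j|] x ij Sx //; last exact: (proj1 De).
  by apply: (proj_orth De) => // ij'; apply: ij; rewrite ij'.
- by move=> x y Sx Sy xy; apply: (proj_inj De) => // i; apply: (xy (Some i)).
- move=> t St; have [i|x Sx xE] := proj_surj De (t := t \o some); first exact: St.
  by exists x => // -[i|//]; apply: xE.
- move=> P Q f sP sQ fPQ fc; apply: (proj_glue De) => // i; exact: (fc (Some i)).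
Qed.

(** If S is not trivial, the factors are the [E i] and, in the last place, the
    trivial fusion system.  If S is trivial, F is itself the trivial fusion
    system and must not be listed twice. *)
Lemma all_indecomposable_factors k (E : 'I_k -> fusion_system gT) :
  no_central_endo F -> indecomposable_factorization F E ->
  exists n (D : 'I_n -> fusion_system gT),
    [/\ injective D,
        range D = [set E' | direct_factor F E' /\ indecomposable E']
      & is_product F D].
Proof.
move=> rigF fE; have [_ pE indE _] := fE.
have full_of E' : direct_factor F E' -> full_subsystem E' F.
  by move=> /direct_factorP[f []].
have [S1|nS] := pselect (S = [set 1]).
  have k1 := factorization_trivial fE S1; subst k; exists 1%N, E; split=> //.
    by move=> i j _; rewrite !ord1.
  apply/seteqP; split=> [_ [i _ <-]|E' [dE' _]].
    by split; [exact: product_direct_factor pE|exact: indE].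
  have fE0 := full_of _ (product_direct_factor ord0 pE); have fE' := full_of _ dE'.
  exists ord0 => //; apply: (full_subsystem_eq fE0 fE').
  by rewrite (factor_trivial fE0 S1) (factor_trivial fE' S1).
have ntE i := factor_nontrivial (i := i) fE nS.
have [e De EP] := product_decomposition pE.
pose D j := if unlift ord_max j is Some i then E i else trivial_fs.
have fD0 : full_subsystem trivial_fs F by exact: restriction_full.
have ul_bij : bijective (@unlift k.+1 ord_max).
  exists (fun o => if o is Some i then lift ord_max i else ord_max) => [j|[i|]].
  - by case: unliftP.
  - by rewrite liftK.
  - exact: unlift_none.
have pD : is_product F D.
  have De' := decomposition_reindex ul_bij (decomposition_option De).
  apply: (decomposition_product De') => j.
  rewrite /D /=; case: unlift => [i|]; first exact: EP.
  split=> //=; apply/seteqP; split=> [_ ->|_ [x _ <-]//].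
  by exists 1 => //; exact: subgroup1 (fsgroupP F).
have D_lift i : D (lift ord_max i) = E i by rewrite /D liftK.
have D_max : D ord_max = trivial_fs by rewrite /D unlift_none.
exists k.+1, D; split=> //.
  move=> i j; have [Di1|nDi] := pselect (fsgroup (D i) = [set 1]); last first.
    by move=> Dij; exact: product_nontrivial_inj pD Dij nDi.
  have max_of l : fsgroup (D l) = [set 1] -> l = ord_max.
    by case: (unliftP ord_max l) => // l' ->; rewrite D_lift => /ntE.
  by move=> Dij; rewrite (max_of i Di1) (max_of j)// -Dij.
apply/seteqP; split=> [_ [j _ <-]|E' [dE' indE']].
  split; first exact: product_direct_factor pD.
  case: (unliftP ord_max j) => [i|] ->; first by rewrite D_lift; exact: indE.
  rewrite D_max => -[E1 [E2 [[_ E1F] _ _]]]; apply: E1F => _ ->.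
  exact: subgroup1 (fsgroupP E1).
have [E'1|nE'] := pselect (fsgroup E' = [set 1]); last first.
  have [i ->] := indecomposable_factor_in rigF pE indE dE' indE' nE'.
  by exists (lift ord_max i).
by exists ord_max => //; rewrite D_max; apply: (full_subsystem_eq fD0 (full_of _ dE')).
Qed.

End AllFactors.

Theorem corollary5p3 (p : nat) (gT : groupType) (F : fusion_system gT) :
  prime p ->
  discrete_p_toral p (fsgroup F) ->
  saturated F p ->
  fscenter F = [set 1] \/ focal_subgroup F = fsgroup F ->
  [/\ exists (k : nat) (E : 'I_k -> fusion_system gT),
        indecomposable_factorization F E,
      forall (k l : nat) (E : 'I_k -> fusion_system gT)
             (D : 'I_l -> fusion_system gT),
        indecomposable_factorization F E ->
        indecomposable_factorization F D ->
        exists2 s : 'I_k -> 'I_l, bijective s & forall i, E i = D (s i)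
    & exists (n : nat) (E : 'I_n -> fusion_system gT),
        [/\ injective E,
            range E = [set D | direct_factor F D /\ indecomposable D]
          & is_product F E]].
Proof.
move=> pr_p tS _ ZF.
have rigF : no_central_endo F.
  by case: ZF; [exact: no_central_endo_center|exact: no_central_endo_focal].
have [k [E fE]] := factorization_exists pr_p tS.
split; first by exists k, E.
- by move=> m l E' D; exact: factorization_unique.
- exact: all_indecomposable_factors rigF fE.
Qed.
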